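(* For every non-negative Borel function $f:\mathbb{R}^d\to[0,\infty)$ and all $\lambda,s>0$, $$\gamma_d(\{Q_\lambda f>s\})\;\ge\;\gamma(\{Q_\lambda f^*>s\}),$$ where $f^*:\mathbb{R}\to[0,\infty]$ is the Gaussian half-line rearrangement of $f$.
   Context: $\gamma_d$ is the standard Gaussian measure on $\mathbb{R}^d$, $\gamma=\gamma_1$, and $\Phi(x)=\gamma((-\infty,x))$ with $\Phi^{-1}(0)=-\infty$, $\Phi^{-1}(1)=\infty$. For Borel $A\subseteq\mathbb{R}^d$, $A^*=\{x\in\mathbb{R}:x<\Phi^{-1}(\gamma_d(A))\}$, and $f^*(x)=\int_0^\infty\mathbf{1}_{\{f>r\}^*}(x)\,dr$ for $x\in\mathbb{R}$. For a non-negative Borel function $h$ on $\mathbb{R}^k$ and $\lambda\in(0,\infty)$, $$Q_\lambda h(z)=\sup_{w\in\mathbb{R}^k}h(z+\lambda w)e^{-\lambda|w|^2/2}=\sup_{w\in\mathbb{R}^k}h(z+w)e^{-|w|^2/(2\lambda)}.$$ On the left $Q_\lambda$ acts on functions on $\mathbb{R}^d$, on the right on functions on $\mathbb{R}$. $Q_\lambda f$ is universally measurable, and measures are extended by completion. *)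

(* Defs.v *)
From HB Require Import structures.
From mathcomp Require Import all_boot all_order all_algebra.
From mathcomp Require Import all_classical all_reals all_analysis.
From mathcomp Require Import measurable_realfun.

Set Implicit Arguments.
Unset Strict Implicit.
Unset Printing Implicit Defensive.

Import Order.TTheory GRing.Theory Num.Theory.
Import numFieldTopology.Exports numFieldNormedType.Exports.

Local Open Scope classical_set_scope.
Local Open Scope ring_scope.

(* Row vectors carry the Borel sigma-algebra, generated by the open sets. *)
HB.instance Definition _ (R : realType) (d : nat) :=
  @isMeasurable.Build (sigma_display (@open 'rV[R]_d)) 'rV[R]_d
    <<s @open 'rV[R]_d >>
    (@sigma_algebra0 _ setT _)
    (@sigma_algebraC 'rV[R]_d _)
    (@sigma_algebra_bigcup _ setT _).

Lemma open_measurable_rV (R : realType) (d : nat) (A : set 'rV[R]_d) :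
  open A -> measurable A.
Proof. exact: sub_sigma_algebra. Qed.

Lemma measurable_fun_rV (R : realType) (d : nat) d' (T : measurableType d')
    (g : T -> 'rV[R]_d) :
  (forall i, measurable_fun setT (fun t => g t ord0 i)) ->
  measurable_fun setT g.
Proof.
move=> mg; apply: (@measurability _ _ _ _ _ _ (@open 'rV[R]_d)) => // B.
move=> [U oU <-]; rewrite setTI.
pose box (qk : 'rV[rat]_d * nat) : set 'rV[R]_d :=
  [set v | forall i, `|v ord0 i - ratr (qk.1 ord0 i)| < qk.2.+1%:R^-1].
have -> : g @^-1` U = \bigcup_qk (if `[< box qk `<=` U >] then g @^-1` box qk
                                  else set0).
  apply/seteqP; split=> [t /= Ut|t [qk _]]; last first.
    by case: asboolP => // sub; exact: sub.
  move: oU; rewrite openE => /(_ _ Ut) /nbhs_ballP[e /= e0 eU].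
  have [k] : exists k : nat, 0 + k.+1%:R^-1 < e / 2.
    by apply: ltr_add_invr; rewrite divr_gt0.
  rewrite add0r => ke.
  have k0 : 0 < k.+1%:R^-1 :> R by rewrite invr_gt0.
  have /choice[q qP] (i : 'I_d) : exists q : rat,
      `|g t ord0 i - ratr q| < k.+1%:R^-1.
    have /rat_in_itvoo[q] : g t ord0 i - k.+1%:R^-1 < g t ord0 i + k.+1%:R^-1.
      by rewrite ltrBlDr -addrA ltrDl addr_gt0.
    by rewrite in_itv/= => qi; exists q; rewrite distrC ltr_distl.
  exists (\row_i q i, k) => //; case: asboolP => [_ i|]; first by rewrite mxE.
  case=> v boxv; apply: eU; split=> // i j; rewrite ord1.
  have := boxv j; rewrite /= mxE => vj; rewrite /ball/=.
  rewrite (le_lt_trans (ler_distD (ratr (q j)) _ _))// [e]splitr ltrD//.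
    exact: lt_trans (qP j) ke.
  by rewrite distrC (lt_trans vj ke).
apply: countable_bigcupT_measurable => [|qk].
  exact: countableP.
case: asboolP => // _.
have -> : g @^-1` box qk = \bigcap_(i in setT)
    (fun t => g t ord0 i) @^-1` ball (ratr (qk.1 ord0 i) : R) (qk.2.+1%:R^-1).
  apply/seteqP; split => t /= bt i => [_|].
    by rewrite /ball/= distrC; exact: bt.
  by rewrite distrC; exact: (bt i I).
apply: fin_bigcap_measurable => // i _.
rewrite -[X in measurable X]setTI; apply: (mg i measurableT).
exact: measurable_ball.
Qed.

Section gaussian_measure.
Context {R : realType}.

Definition rV_cons (d : nat) (p : measurableTypeR R * 'rV[R]_d) : 'rV[R]_d.+1 :=
  row_mx (p.1)%:M p.2.

Lemma measurable_coord_rV (d : nat) (i : 'I_d) :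
  measurable_fun setT (fun v : 'rV[R]_d => v ord0 i).
Proof.
apply: (measurability _ (RGenOpens.measurableE R)) => _ [_ [a [b ->] <-]].
rewrite setTI; apply: open_measurable_rV.
by apply: open_comp (interval_open _ _) => // v _; exact: coord_continuous.
Qed.

Lemma measurable_rV_cons (d : nat) : measurable_fun setT (@rV_cons d).
Proof.
apply: measurable_fun_rV => i.
have [j ->|j ->] := @split_ordP 1 d i.
  rewrite [X in measurable_fun _ X](_ : _ = fst); first exact: measurable_fst.
  apply/funext => p; apply: (etrans (row_mxEl _ _ _ _)).
  by rewrite !ord1 mxE eqxx mulr1n.
rewrite [X in measurable_fun _ X](_ : _ = (fun v : 'rV[R]_d => v ord0 j) \o snd).
  by apply: measurableT_comp; [exact: measurable_coord_rV|exact: measurable_snd].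
by apply/funext => p; exact: row_mxEr.
Qed.

HB.instance Definition _ (d : nat) :=
  isMeasurableFun.Build _ _ _ _ (@rV_cons d) (@measurable_rV_cons d).

Definition gamma : probability (measurableTypeR R) R := normal_prob (0 : R) 1.

(* The product of d copies of gamma, transported to 'rV[R]_d. *)
Fixpoint gaussian (d : nat) : probability 'rV[R]_d R :=
  match d with
  | 0 => dirac (0 : 'rV[R]_0)
  | d'.+1 => distribution (gamma \x gaussian d')%E (@rV_cons d')
  end.

End gaussian_measure.

Section rearrangement.
Context {R : realType}.
Local Open Scope ereal_scope.

Definition Phi (x : R) : \bar R := gamma `]-oo, x[%classic.

Definition Phi_inv (p : \bar R) : \bar R :=
  if p == 0 then -oo
  else if p == 1 then +oo
  else (get [set x : R | Phi x = p])%:E.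

Definition set_star (d : nat) (A : set 'rV[R]_d) : set R :=
  [set x : R | x%:E < Phi_inv (gaussian d A)].

Definition fun_star (d : nat) (f : 'rV[R]_d -> R) (x : R) : \bar R :=
  \int[lebesgue_measure]_(r in `]0%R, +oo[)
    (\1_(set_star [set y | (r < f y)%R]) x)%:E.

End rearrangement.

Section sup_convolution.
Context {R : realType}.

(* The norm on 'rV[R]_d provided by the library is the sup norm. *)
Definition enorm (d : nat) (w : 'rV[R]_d) : R :=
  Num.sqrt (\sum_(i < d) w ord0 i ^+ 2).

Definition Q (V : lmodType R) (nrm : V -> R) (lambda : R) (h : V -> \bar R)
    (z : V) : \bar R :=
  ereal_sup
    [set (h (z + lambda *: w)%R * (expR (- (lambda * nrm w ^+ 2 / 2)))%:E)%E
    | w in [set: V]].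

Definition Q_rV (d : nat) : R -> ('rV[R]_d -> \bar R) -> 'rV[R]_d -> \bar R :=
  Q (@enorm d).

Definition Q_R : R -> (R -> \bar R) -> R -> \bar R :=
  Q (fun x : R^o => `|x|).

Lemma enorm_continuous (d : nat) : continuous (@enorm d).
Proof.
move=> w; apply: continuous_comp; last exact: sqrt_continuous.
apply: (cvg_big (op := +%R)) => [||i _]; [exact: add_continuous|exact: nbhs_filter|].
apply: (@continuous_comp _ _ _ (fun v : 'rV[R]_d => v ord0 i)
  (fun x : R => x ^+ 2)); first exact: coord_continuous.
exact: exprn_continuous.
Qed.

(* The superlevel sets of Q are open whatever h is, so they are Borel and the
   completion of the measures is not needed to measure them. *)
Lemma open_Q_gt (V : normedModType R) (nrm : V -> R) (lambda s : R)
    (h : V -> \bar R) :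
  continuous nrm -> 0 < lambda ->
  open [set z | (s%:E < Q nrm lambda h z)%E].
Proof.
move=> cnrm l0.
pose e (y z : V) := expR (- (lambda * nrm (lambda^-1 *: (y - z)) ^+ 2 / 2)).
have ce y : continuous (e y).
  have cu : continuous (fun z : V => lambda^-1 *: (y - z)).
    by move=> z; apply: cvgZl_tmp; apply: cvgB; [exact: cvg_cst|exact: cvg_id].
  have cn : continuous (fun z : V => nrm (lambda^-1 *: (y - z)) ^+ 2).
    move=> z; apply: (continuous_comp _ (@exprn_continuous R 2 _)).
    exact: (continuous_comp (cu z) (cnrm _)).
  have cm : continuous (fun z : V =>
      - (lambda * nrm (lambda^-1 *: (y - z)) ^+ 2 / 2)).
    by move=> z; apply: cvgN; apply: cvgMr_tmp; apply: cvgMl_tmp; exact: cn.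
  by move=> z; exact: (continuous_comp (cm z) (@continuous_expR R _)).
rewrite [X in open X](_ : _ =
    \bigcup_y [set z | (s%:E < h y * (e y z)%:E)%E]); last first.
  apply/seteqP; split=> [z /=|z [y _ /= syz]].
    rewrite /Q => /ereal_sup_gt[_ [w _ <-] sw].
    exists (z + lambda *: w) => //=.
    by rewrite /e addrAC subrr add0r scalerA mulVf ?gt_eqF// scale1r.
  apply: (lt_le_trans syz); apply: ereal_sup_ubound.
  exists (lambda^-1 *: (y - z)) => //.
  by rewrite scalerA mulfV ?gt_eqF// scale1r addrC subrK.
apply: bigcup_open => y _; case: (h y) => [r| |].
- rewrite [X in open X](_ : _ = (fun z => r * e y z) @^-1` [set x | s < x]).
    apply: open_comp; last exact: open_gt.
    by move=> z _; apply: cvgMl_tmp; exact: ce.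
  by apply/seteqP; split=> z /=; rewrite -EFinM lte_fin.
- rewrite [X in open X](_ : _ = setT); first exact: openT.
  by apply/seteqP; split=> z //= _; rewrite gt0_mulye ?lte_fin ?expR_gt0 ?ltry.
- rewrite [X in open X](_ : _ = set0); first exact: open0.
  by apply/seteqP; split=> z //=; rewrite gt0_mulNye ?lte_fin ?expR_gt0.
Qed.

Lemma measurable_Q_rV_gt (d : nat) (lambda s : R) (h : 'rV[R]_d -> \bar R) :
  0 < lambda -> measurable [set z | (s%:E < Q_rV lambda h z)%E].
Proof.
by move=> l0; apply: open_measurable_rV; exact: open_Q_gt (@enorm_continuous d) l0.
Qed.

Lemma measurable_Q_R_gt (lambda s : R) (h : R -> \bar R) :
  0 < lambda -> measurable [set z : R | (s%:E < Q_R lambda h z)%E].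
Proof.
move=> l0; apply: open_measurable.
by apply: (@open_Q_gt R^o) l0; exact: norm_continuous.
Qed.

End sup_convolution.

(* Main.v *)
(* For r > s put rho(r) = sqrt(2 lambda log(r / s)). The set {Q f > s} contains
   the rho(r)-neighbourhood of {f > r}, while {Q f^* > s} is the union over r of
   the half-lines of measure Phi(Phi^-1(gamma_d {f > r}) + rho(r)), so the theorem
   is the Gaussian isoperimetric inequality for neighbourhoods of Borel sets.

   The latter follows Bobkov. With I = phi o Phi^-1, so that I I'' = - 1, the
   two-point inequality I((a + b) / 2) <= E sqrt(I^2 + ((a - b) / 2)^2) tensorises,
   by Minkowski's inequality, along random walks with steps +- t e_i. For a cutoff
   of width eps of a smoothed distance to a finite set, the central limit theorem
   turns it into I(m) <= (1 + 1 / eps) (v(r + eps) - v(r)) for the measure v(r) of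
   the r-neighbourhood and some m between v(r) and v(r + eps). Hence
   Phi^-1(v(r)) - r is nondecreasing. Finite sets suffice, since A is covered by
   balls centred at a sequence of points of A. *)
Require Import Defs.
From mathcomp Require Import all_boot all_order all_algebra.
From mathcomp Require Import all_classical all_reals all_analysis.
From mathcomp Require Import measurable_realfun ring lra.

Import Order.TTheory GRing.Theory Num.Theory.
Import numFieldTopology.Exports numFieldNormedType.Exports.

Local Open Scope classical_set_scope.
Local Open Scope ring_scope.
Set Implicit Arguments.
Unset Strict Implicit.
Unset Printing Implicit Defensive.

(** The obstacle is that the factor [1 + 1 / eps] must not depend on [d]. Lipschitz bounds along the
    axes alone would give [sqrt d / eps], so the smoothed distance carries a gradient of Euclidean
    norm at most [1] with an explicit [O(t^2)] remainder along each axis. With [N] steps of length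
    [t = 1 / sqrt N] per axis, the squared discrete derivatives of the cutoff add up to at most
    [1 / eps^2 + O(t)], and the error disappears as [N] grows. The summand [1] bounds [I] of the
    cutoff on the band where it is neither [0] nor [1]. It is harmless: over a mesh of width
    [delta], with [eps] close to [delta], the inequality makes [Phi^-1(v(r))] grow by
    [delta - O(delta^2)], and the losses sum to [O(delta)]. The central limit theorem comes with a
    threshold uniform over Lipschitz functions, because the induction on the dimension applies it to
    all slices of a function at once. *)

Section pointwise_derivatives.
Context {R : realType}.
Implicit Types (f g : R -> R) (x a b : R).

(** With each rule stated for an explicit abstraction and a free value, a whole derivative is
    assembled as one term, leaving a single algebraic goal for its value. *)
Lemma is_derive1_eq f x a b : is_derive x 1 f a -> a = b -> is_derive x 1 f b.
Proof. by move=> ? <-. Qed.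

Lemma is_derive1D f g x a b : is_derive x 1 f a -> is_derive x 1 g b ->
  is_derive x 1 (fun y => f y + g y) (a + b).
Proof. exact: is_deriveD. Qed.

Lemma is_derive1B f g x a b : is_derive x 1 f a -> is_derive x 1 g b ->
  is_derive x 1 (fun y => f y - g y) (a - b).
Proof. exact: is_deriveB. Qed.

Lemma is_derive1N f x a : is_derive x 1 f a ->
  is_derive x 1 (fun y => - f y) (- a).
Proof. exact: is_deriveN. Qed.

Lemma is_derive1M f g x a b : is_derive x 1 f a -> is_derive x 1 g b ->
  is_derive x 1 (fun y => f y * g y) (f x * b + g x * a).
Proof. exact: is_deriveM. Qed.

Lemma is_derive1X2 f x a : is_derive x 1 f a ->
  is_derive x 1 (fun y => f y ^+ 2) (2 * f x * a).
Proof. by move=> h; apply: is_derive1_eq (is_derive1M h h) _; ring. Qed.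

Lemma is_derive1C x a : is_derive x 1 (fun _ : R => a) 0.
Proof. exact: is_derive_cst. Qed.

Lemma is_derive1I x : is_derive x 1 (fun y : R => y) 1.
Proof. exact: is_derive_id. Qed.

Lemma is_derive1O f g x a b : is_derive (g x) 1 f a -> is_derive x 1 g b ->
  is_derive x 1 (fun y => f (g y)) (a * b).
Proof. exact: is_derive1_comp. Qed.

Lemma is_derive1_cont f x a : is_derive x 1 f a -> {for x, continuous f}.
Proof.
by move=> [h _]; apply: differentiable_continuous; apply/derivable1_diffP.
Qed.

End pointwise_derivatives.

(** Continuity from below, contraposed. It supplies the limits of [Ph] at infinity and later the
    reduction to finite nets. *)
Lemma probability_bigcup_gt d (T : measurableType d) (R : realType)
    (mu : probability T R) (F : (set T)^nat) (p : \bar R) :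
  (forall n, measurable (F n)) -> {homo F : i j / (i <= j)%N >-> i `<=` j} ->
  (p < mu (\bigcup_n F n))%E -> exists n, (p < mu (F n))%E.
Proof.
move=> mF ndF pU; apply: contrapT => /forallNP h.
have : mu (F n) @[n --> \oo] --> mu (\bigcup_n F n).
  apply: nondecreasing_cvg_mu => //; first exact: bigcup_measurable.
  by move=> i j ij; apply/subsetPset; exact: ndF.
move=> cF; have : (mu (\bigcup_n F n) <= p)%E.
  rewrite -(cvg_lim _ cF)//; apply: lime_le.
    by apply/cvg_ex; eexists; exact: cF.
  by apply: nearW => n; rewrite leNgt; apply/negP; exact: h.
by rewrite leNgt pU.
Qed.

(** * The Gaussian isoperimetric profile *)

Section gauss_line.
Context {R : realType}.
Implicit Types x y p : R.

Definition phi x : R := normal_pdf 0 1 x.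
Definition Ph x : R := fine (Phi x).

Lemma phiE x : phi x = (Num.sqrt (pi *+ 2))^-1 * expR (- (x ^+ 2 / 2)).
Proof.
rewrite /phi normal_pdfE ?oner_eq0// /normal_peak /normal_fun expr1n mul1r subr0.
by rewrite mulNr.
Qed.

Lemma phi_gt0 x : 0 < phi x.
Proof.
by rewrite phiE mulr_gt0 ?expR_gt0// invr_gt0 sqrtr_gt0 mulrn_wgt0// pi_gt0.
Qed.

Lemma Phi_fin x : Phi x = (Ph x)%:E.
Proof. by rewrite /Ph fineK// fin_num_measure//; exact: measurable_itv. Qed.

Lemma is_derive_phi x : is_derive x 1 phi (- x * phi x).
Proof.
have -> : phi = (fun x => (Num.sqrt (pi *+ 2))^-1 * expR (- (x ^+ 2 / 2))).
  by apply/funext => y; exact: phiE.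
have h : is_derive x 1 (fun y : R => - (y ^+ 2 / 2)) (- x).
  by apply: is_derive1_eq; rewrite /GRing.scale/=; field.
apply: is_derive1_eq
  (is_derive1M (is_derive1C _ _) (is_derive1O (is_derive_expR _) h)) _.
by rewrite /=; ring.
Qed.

Lemma continuous_phi : continuous phi.
Proof. by apply: continuous_normal_pdf; exact: oner_neq0. Qed.

Lemma PhE x : Ph x = \int[lebesgue_measure]_(t in `]-oo, x]) phi t.
Proof.
rewrite /Ph /Phi /Rintegral/=/normal_prob; congr fine.
rewrite integral_itv_bndo_bndc//.
apply: measurable_funTS; apply: measurableT_comp => //.
exact: measurable_normal_pdf.
Qed.

Lemma is_derive_Ph x : is_derive x 1 Ph (phi x).
Proof.
have -> : Ph = (fun y =>
    \int[lebesgue_measure]_(t in [set` Interval -oo%O (BRight y)]) phi t).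
  by apply/funext => y; exact: PhE.
have [||||h1 h2] := @continuous_FTC1 _ phi -oo%O x (x + 1).
- by rewrite ltrDl.
- apply: (integrableS (E := setT)) => //; exact: integrable_normal_pdf.
- by rewrite ltNyr.
- exact: continuous_phi.
by split => //; rewrite -h2 derive1E.
Qed.

Lemma continuous_Ph : continuous Ph.
Proof.
by move=> x; exact: is_derive1_cont (is_derive_Ph x).
Qed.

Lemma Ph_lt x y : x < y -> Ph x < Ph y.
Proof.
move=> xy; have [|c _ e] := @MVT _ Ph phi x y xy (fun z _ => is_derive_Ph z).
  by apply: continuous_subspaceT; exact: continuous_Ph.
by rewrite -subr_gt0 e mulr_gt0 ?phi_gt0// subr_gt0.
Qed.

Lemma Ph_ltE x y : (Ph x < Ph y) = (x < y).
Proof. by apply: leW_mono; apply: le_mono; exact: Ph_lt. Qed.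

Lemma Ph_leE x y : (Ph x <= Ph y) = (x <= y).
Proof. by apply: le_mono; exact: Ph_lt. Qed.

Lemma Ph_ge0 x : 0 <= Ph x.
Proof. by rewrite /Ph fine_ge0. Qed.

Lemma Ph_le1 x : Ph x <= 1.
Proof.
by rewrite -lee_fin -Phi_fin; apply: probability_le1; exact: measurable_itv.
Qed.

Lemma Ph_gt0 x : 0 < Ph x.
Proof. by apply: (le_lt_trans (Ph_ge0 (x - 1))); apply: Ph_lt; rewrite gtrBl. Qed.

Lemma Ph_lt1 x : Ph x < 1.
Proof. by apply: (lt_le_trans _ (Ph_le1 (x + 1))); apply: Ph_lt; rewrite ltrDl. Qed.

Lemma Ph_exists_gt p : p < 1 -> exists x, p < Ph x.
Proof.
move=> p1; pose F (n : nat) : set (measurableTypeR R) := `]-oo, n%:R[%classic.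
have [|||n pn] := @probability_bigcup_gt _ _ _ gamma F p%:E.
- by move=> i; exact: measurable_itv.
- by move=> i j ij; apply: subset_itvl; rewrite bnd_simp ler_nat.
- rewrite (_ : \bigcup_n F n = setT) ?probability_setT ?lte_fin//.
  apply/seteqP; split => // t _; exists (Num.truncn t).+1 => //=.
  by rewrite /F/= in_itv/= truncnS_gt.
by exists n%:R; rewrite -lte_fin -Phi_fin.
Qed.

Lemma Ph_exists_lt p : 0 < p -> exists x, Ph x < p.
Proof.
move=> p0; pose F (n : nat) : set (measurableTypeR R) := `[- n%:R, +oo[%classic.
have [|||n pn] := @probability_bigcup_gt _ _ _ gamma F (1 - p)%:E.
- by move=> i; exact: measurable_itv.
- by move=> i j ij; apply: subset_itvr; rewrite bnd_simp lerN2 ler_nat.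
- rewrite (_ : \bigcup_n F n = setT) ?probability_setT ?lte_fin ?gtrBl//.
  apply/seteqP; split => // t _; exists (Num.truncn (- t)).+1 => //=.
  by rewrite /F/= in_itv/= andbT lerNl ltW// truncnS_gt.
exists (- n%:R); move: pn; rewrite -(setCK (F n)) probability_setC; last first.
  by apply: measurableC; exact: measurable_itv.
rewrite /F setCitvr/= -/(Phi _) Phi_fin -EFinB lte_fin; lra.
Qed.

Lemma Ph_surj p : 0 < p < 1 -> exists x, Ph x = p.
Proof.
move=> /andP[/Ph_exists_lt[a ap] /Ph_exists_gt[b pb]].
have ab : a <= b by rewrite -Ph_leE (le_trans (ltW ap))// ltW.
have [||c _ <-] := @IVT _ Ph a b p ab; last by exists c.
  by apply: continuous_subspaceT; exact: continuous_Ph.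
by rewrite min_l ?max_r ?Ph_leE// (ltW ap) (ltW pb).
Qed.

(** The quantile function as a real function that can be differentiated, unlike [Phi_inv]; outside
    []0, 1[], where [Ph] takes no value, it is the default [0]. *)
Definition qn p : R := xget 0 [set x | Ph x = p].

Lemma Ph_qn p : 0 < p < 1 -> Ph (qn p) = p.
Proof. by move=> /Ph_surj[x xp]; rewrite /qn; case: xgetP => // /(_ x). Qed.

Lemma Ph_inj x y : Ph x = Ph y -> x = y.
Proof.
by move=> e; apply: le_anti; rewrite -Ph_leE e lexx/= -Ph_leE e lexx.
Qed.

Lemma qn_Ph x : qn (Ph x) = x.
Proof. by apply: Ph_inj; rewrite Ph_qn// Ph_gt0 Ph_lt1. Qed.

Lemma is_derive_qn p : 0 < p < 1 -> is_derive p 1 qn (phi (qn p))^-1.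
Proof.
move=> p01; rewrite -{1}(Ph_qn p01); apply: is_derive_inverse.
- by near=> x; exact: qn_Ph.
- by near=> x; exact: continuous_Ph.
- exact: is_derive_Ph.
- by rewrite gt_eqF// phi_gt0.
Unshelve. all: by end_near. Qed.

Lemma qn_le p q : 0 < p < 1 -> 0 < q < 1 -> (qn p <= qn q) = (p <= q).
Proof. by move=> p1 q1; rewrite -Ph_leE !Ph_qn. Qed.

Lemma phiN x : phi (- x) = phi x.
Proof. by rewrite !phiE sqrrN. Qed.

(** Evenness of [phi] makes [Ph (- y) + Ph y] constant; letting [y] run to either end identifies the
    constant as [1]. *)
Lemma PhN x : Ph (- x) = 1 - Ph x.
Proof.
have D (y : R) : is_derive y 1 (fun y => Ph (- y) + Ph y) 0.
  apply: is_derive1_eq (is_derive1D (is_derive1O (is_derive_Ph _)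
    (is_derive1N (is_derive1I _))) (is_derive_Ph _)) _.
  by rewrite phiN mulrN1 addNr.
have c : forall y, Ph (- y) + Ph y = Ph (- 0) + Ph 0.
  by move=> y; exact: (is_derive_0_is_cst (f := fun y => Ph (- y) + Ph y)).
suff e : Ph (- 0) + Ph 0 = 1 by rewrite -e -(c x) addrK.
apply/eqP; rewrite eq_le; apply/andP; split; apply/ler_addgt0Pr => e e0.
  have [y ye] := Ph_exists_lt e0; rewrite -(c y).
  by have := Ph_le1 (- y); lra.
have [|y ye] := @Ph_exists_gt (1 - e); first by rewrite gtrBl.
by rewrite -(c y); have := Ph_ge0 (- y); lra.
Qed.

(** The value [0] off []0, 1[] is the continuous extension, since [phi] vanishes at infinity;
    [phi (qn p)] alone would give [phi 0] there. *)
Definition Iso p : R := if 0 < p < 1 then phi (qn p) else 0.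

Lemma Iso0 : Iso 0 = 0. Proof. by rewrite /Iso ltxx. Qed.
Lemma Iso1 : Iso 1 = 0. Proof. by rewrite /Iso ltxx andbF. Qed.

Lemma Iso_ge0 p : 0 <= Iso p.
Proof. by rewrite /Iso; case: ifP => // _; rewrite ltW// phi_gt0. Qed.

Lemma is_derive_Iso p : 0 < p < 1 -> is_derive p 1 Iso (- qn p).
Proof.
move=> p01; apply: (@near_eq_is_derive _ _ _ (phi \o qn)).
- have /andP[p0 p1] := p01; near=> q; rewrite /Iso/= ifT//; apply/andP; split.
    by near: q; exact: lt_nbhsr.
  by near: q; exact: lt_nbhsl.
- apply: is_derive1_eq (is_derive1O (is_derive_phi _) (is_derive_qn p01)) _.
  by rewrite mulfK// gt_eqF// phi_gt0.
Unshelve. all: by end_near. Qed.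

Let peak_le1 : (Num.sqrt (pi *+ 2))^-1 <= 1 :> R.
Proof.
have p2 : 1 <= pi *+ 2 :> R by have := @pi_ge2 R; lra.
rewrite invf_le1; last by rewrite sqrtr_gt0; lra.
by rewrite -sqrtr1 ler_sqrt//; lra.
Qed.

Lemma phi_le1 x : phi x <= 1.
Proof.
have h := peak_le1.
rewrite phiE mulr_ile1 ?expR_ge0 ?invr_ge0//.
by rewrite -expR0 ler_expR oppr_le0 divr_ge0// sqr_ge0.
Qed.

Lemma phi_sqr_le x : phi x * x ^+ 2 <= 2.
Proof.
have h := peak_le1.
have : expR (- (x ^+ 2 / 2)) * x ^+ 2 <= 2.
  rewrite expRN ler_pdivrMl ?expR_gt0//.
  have := expR_ge1Dx (x ^+ 2 / 2); have := sqr_ge0 x; nra.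
rewrite phiE; have := expR_gt0 (- (x ^+ 2 / 2)); have := sqr_ge0 x.
have : 0 <= (Num.sqrt (pi *+ 2))^-1 :> R by rewrite invr_ge0.
move: h; set c := (_)^-1; set E := expR _; set q := x ^+ 2.
move=> c1 c0 q0 E0 Eq.
have : 0 <= E * q by rewrite mulr_ge0// ltW.
rewrite -mulrA; nra.
Qed.

Lemma Iso_cont0 e : 0 < e -> exists2 t, 0 < t & forall p, p < t -> Iso p < e.
Proof.
(* With [d = 2 / e], [p] below this threshold forces [qn p < - (1 + d)]; if [phi (qn p) >= e], then
   [phi (qn p) * qn p ^+ 2 > e * (1 + d) ^+ 2 >= 4], against [phi_sqr_le]. *)
move=> e0; exists (Ph (- (1 + 2 / e))); first exact: Ph_gt0.
move=> p pt; rewrite /Iso; case: ifPn => // p01.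
move: pt; rewrite -{1}(Ph_qn p01) Ph_ltE => h.
have := phi_sqr_le (qn p); have := phi_gt0 (qn p); move: h.
have d0 : 0 < 2 / e by rewrite divr_gt0.
have : e * (2 / e) = 2 by field; rewrite gt_eqF.
set q := qn p; set d := 2 / e in d0 *; set f := phi q => ed qd f0 fq.
rewrite ltNge; apply/negP => ef.
have : (1 + d) ^+ 2 < q ^+ 2 by rewrite -(sqrrN q) ltr_sqr ?nnegrE; lra.
nra.
Qed.

Lemma Iso_sym p : Iso (1 - p) = Iso p.
Proof.
rewrite /Iso; have -> : (0 < 1 - p < 1) = (0 < p < 1) by apply/idP/idP; lra.
case: ifPn => // p01; rewrite -{1}(Ph_qn p01) -PhN qn_Ph phiN//.
Qed.

End gauss_line.

(** * Bobkov's two-point inequality *)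

Section bobkov_two_point.
Context {R : realType}.
Implicit Types a b c p q t x y : R.

Lemma le_of_derive_ge0 (f df : R -> R) a b : a <= b ->
  (forall t, a <= t <= b -> is_derive t 1 f (df t)) ->
  (forall t, a <= t <= b -> 0 <= df t) -> f a <= f b.
Proof.
move=> ab D p; have [||c cab e] := @MVT_segment _ f df a b ab.
- by move=> t tab; apply: D; move: tab; rewrite in_itv/=; lra.
- apply: derivable_within_continuous => t; rewrite in_itv/= => tab.
  by have [] := D t tab.
by rewrite -subr_ge0 e mulr_ge0 ?subr_ge0 ?p//; move: cab; rewrite in_itv.
Qed.

Lemma continuous_Iso : continuous (@Iso R).
Proof.
have near0 e : 0 < e -> \forall p \near (0 : R), `|Iso p| < e.
  move=> e0; have [t t0 h] := Iso_cont0 e0.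
  by near=> p; rewrite ger0_norm ?Iso_ge0// h//; near: p; exact: lt_nbhsl.
move=> p; have [p0|p0|->] := ltgtP p 0; last first.
- apply/cvgrPdist_lt => e e0; rewrite Iso0.
  by near=> q; rewrite sub0r normrN; near: q; exact: near0.
- have [p1|p1|->] := ltgtP p 1; last first.
  + apply/cvgrPdist_lt => e e0; rewrite Iso1.
    have [t t0 h] := Iso_cont0 e0.
    near=> q; rewrite sub0r normrN -Iso_sym ger0_norm ?Iso_ge0// h//.
    by rewrite ltrBlDl -ltrBlDr; near: q; apply: lt_nbhsr; rewrite gtrBl.
  + apply: (@near_cst_continuous _ _ 0); near=> q; rewrite /Iso ifF//.
    apply/negP => /andP[_]; apply/negP; rewrite -leNgt ltW//.
    by near: q; exact: lt_nbhsr.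
  + by apply: is_derive1_cont (is_derive_Iso _); rewrite p0 p1.
- apply: (@near_cst_continuous _ _ 0); near=> q; rewrite /Iso ifF//.
  apply/negP => /andP[+ _]; apply/negP; rewrite -leNgt ltW//.
  by near: q; exact: lt_nbhsl.
Unshelve. all: by end_near. Qed.

Lemma qnN p : 0 < p < 1 -> qn (1 - p) = - qn p.
Proof. by move=> p01; rewrite -{1}(Ph_qn p01) -PhN qn_Ph. Qed.

Lemma phi_ler x y : x ^+ 2 <= y ^+ 2 -> phi y <= phi x.
Proof.
move=> xy; rewrite !phiE ler_wpM2l ?invr_ge0// ler_expR; lra.
Qed.

(** At [x = qn p], [2 * x / phi x] is the derivative of [qn p ^+ 2], so this is the convexity of
    [qn ^+ 2]. *)
Lemma divphi_le x y : x <= y -> x / phi x <= y / phi y.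
Proof.
move=> xy; have fx := phi_gt0 x; have fy := phi_gt0 y.
rewrite ler_pdivrMr// mulrAC ler_pdivlMr//.
have [x0|x0] := leP 0 x.
  have : phi y <= phi x by apply: phi_ler; rewrite ler_sqr ?nnegrE; lra.
  nra.
have [y0|y0] := leP 0 y; first nra.
have : phi x <= phi y.
  by apply: phi_ler; rewrite -sqrrN -(sqrrN x) ler_sqr ?nnegrE; lra.
nra.
Qed.

(** By [dK] and [dIq], [K'' = 2 * qn ^+ 2 - 2]; the added square [t ^+ 2] of the two-point
    inequality removes the [- 2]. *)
Let K p := Iso p ^+ 2.

Let dK p : 0 < p < 1 -> is_derive p 1 K (- 2 * (Iso p * qn p)).
Proof.
move=> p01; refine (is_derive1_eq (is_derive1X2 (is_derive_Iso p01)) _).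
by ring.
Qed.

Let dIq p : 0 < p < 1 -> is_derive p 1 (fun p => Iso p * qn p) (1 - qn p ^+ 2).
Proof.
move=> p01.
refine (is_derive1_eq (is_derive1M (is_derive_Iso p01) (is_derive_qn p01)) _).
have -> : Iso p = phi (qn p) by rewrite /Iso p01.
by have := phi_gt0 (qn p) => h; field; rewrite gt_eqF.
Qed.

Let dDr (f : R -> R) c t a : is_derive (c + t) 1 f a ->
  is_derive t 1 (fun t => f (c + t)) a.
Proof.
move=> h; refine (is_derive1_eq (is_derive1O h
  (is_derive1D (is_derive1C _ _) (is_derive1I _))) _).
by rewrite add0r mulr1.
Qed.

Let dBr (f : R -> R) c t a : is_derive (c - t) 1 f a ->
  is_derive t 1 (fun t => f (c - t)) (- a).
Proof.
move=> h; refine (is_derive1_eq (@is_derive1O _ f (fun t => c - t) t _ _ h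
  (is_derive1B (is_derive1C _ _) (is_derive1I _))) _).
by rewrite sub0r mulrN1.
Qed.

(** For [c <= 1 / 2] the point [c - t] is at least as far from [1 / 2] as [c + t], and [qn ^+ 2] is
    symmetric about [1 / 2] and grows away from it. *)
Lemma qn_sqr_anti c x t (x0 : 0 <= x) (cx0 : 0 < c - x)
    (cx1 : c + x < 1) (c2 : c <= 1 / 2) :
  0 <= t <= x -> qn (c + t) ^+ 2 <= qn (c - t) ^+ 2.
Proof.
move=> tx; have h1 : qn (c - t) <= qn (c + t).
  by rewrite qn_le; lra.
have h2 : qn (c - t) <= - qn (c + t).
  by rewrite -qnN ?qn_le; lra.
nra.
Qed.

Lemma qn_sqr_convex c x t (x0 : 0 <= x) (cx0 : 0 < c - x)
    (cx1 : c + x < 1) (c2 : c <= 1 / 2) :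
  0 <= t <= x ->
  2 * qn c ^+ 2 <= qn (c + t) ^+ 2 + qn (c - t) ^+ 2.
Proof.
move=> /andP[t0 tx].
have /= := @le_of_derive_ge0 (fun t => qn (c + t) ^+ 2 + qn (c - t) ^+ 2)
  (fun t => 2 * (qn (c + t) / phi (qn (c + t)) - qn (c - t) / phi (qn (c - t)))) 0 t t0.
rewrite addr0 subr0 => h; rewrite mulr_natl mulr2n; apply: h => u ut.
- have [pu mu] : 0 < c + u < 1 /\ 0 < c - u < 1 by split; lra.
  refine (is_derive1_eq (is_derive1D
    (is_derive1X2 (dDr (is_derive_qn pu))) (is_derive1X2 (dBr (is_derive_qn mu)))) _).
  ring.
- by rewrite mulr_ge0// subr_ge0 divphi_le// qn_le; lra.
Qed.

(** The difference of the two sides vanishes to first order at [x = 0], and its second derivative is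
    nonnegative by [qn_sqr_convex]. *)
Lemma Iso_sqr_sum c x (x0 : 0 <= x) (cx0 : 0 < c - x)
    (cx1 : c + x < 1) (c2 : c <= 1 / 2) :
  2 * K c + 2 * x ^+ 2 * qn c ^+ 2 <=
  K (c + x) + K (c - x) + 2 * x ^+ 2.
Proof.
pose S1 t := - 2 * (Iso (c + t) * qn (c + t)) + 2 * (Iso (c - t) * qn (c - t))
  + 4 * t - 4 * t * qn c ^+ 2.
pose S t := K (c + t) + K (c - t) + 2 * t ^+ 2 - 2 * t ^+ 2 * qn c ^+ 2.
have S1_ge0 t : 0 <= t <= x -> 0 <= S1 t.
  move=> /andP[t0 tx].
  have -> : 0 = S1 0 by rewrite /S1 !addr0 !subr0; ring.
  apply: (@le_of_derive_ge0 S1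
   (fun t => 2 * qn (c + t) ^+ 2 + 2 * qn (c - t) ^+ 2 - 4 * qn c ^+ 2)) => // u ut.
  + have [pu mu] : 0 < c + u < 1 /\ 0 < c - u < 1 by split; lra.
    refine (is_derive1_eq (is_derive1B (is_derive1D (is_derive1D
      (is_derive1M (is_derive1C _ _) (dDr (dIq pu)))
      (is_derive1M (is_derive1C _ _) (dBr (dIq mu))))
      (is_derive1M (is_derive1C _ _) (is_derive1I _)))
      (is_derive1M (is_derive1M (is_derive1C _ _) (is_derive1I _)) (is_derive1C _ _))) _).
    ring.
  + have ux : 0 <= u <= x by lra.
    by have := qn_sqr_convex x0 cx0 cx1 c2 ux; lra.
have : S 0 <= S x.
  apply: (@le_of_derive_ge0 S S1 _ _ x0 _ S1_ge0) => u ut.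
  have [pu mu] : 0 < c + u < 1 /\ 0 < c - u < 1 by split; lra.
  refine (is_derive1_eq (is_derive1B (is_derive1D (is_derive1D
    (dDr (dK pu)) (dBr (dK mu)))
    (is_derive1M (is_derive1C _ _) (is_derive1X2 (is_derive1I _))))
    (is_derive1M (is_derive1M (is_derive1C _ _) (is_derive1X2 (is_derive1I _)))
      (is_derive1C _ _))) _).
  by rewrite /S1; ring.
by rewrite /S !addr0 !subr0; lra.
Qed.

(** For the upper bound, again integrate twice from [0]: the second derivative of the gap is
    [2 * (qn (c - t) ^+ 2 - qn (c + t) ^+ 2)], nonnegative by [qn_sqr_anti], which also gives the
    lower bound. *)
Lemma Iso_sqr_diff c x (x0 : 0 <= x) (cx0 : 0 < c - x)
    (cx1 : c + x < 1) (c2 : c <= 1 / 2) :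
  0 <= K (c + x) - K (c - x) <= - 4 * x * (Iso c * qn c).
Proof.
apply/andP; split.
  have xx : 0 <= x <= x by lra.
  have [pu mu] : 0 < c + x < 1 /\ 0 < c - x < 1 by split; lra.
  rewrite subr_ge0 ler_sqr ?nnegrE ?Iso_ge0// /Iso pu mu.
  exact: phi_ler (qn_sqr_anti x0 cx0 cx1 c2 xx).
pose S1 t := 2 * (Iso (c + t) * qn (c + t)) + 2 * (Iso (c - t) * qn (c - t))
  - 4 * (Iso c * qn c).
pose S t := - 4 * t * (Iso c * qn c) - (K (c + t) - K (c - t)).
have S1_ge0 t : 0 <= t <= x -> 0 <= S1 t.
  move=> /andP[t0 tx].
  have -> : 0 = S1 0 by rewrite /S1 !addr0 !subr0; ring.
  apply: (@le_of_derive_ge0 S1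
   (fun t => - 2 * qn (c + t) ^+ 2 + 2 * qn (c - t) ^+ 2)) => // u ut.
  + have [pu mu] : 0 < c + u < 1 /\ 0 < c - u < 1 by split; lra.
    refine (is_derive1_eq (is_derive1B (is_derive1D
      (is_derive1M (is_derive1C _ _) (dDr (dIq pu)))
      (is_derive1M (is_derive1C _ _) (dBr (dIq mu)))) (is_derive1C _ _)) _).
    ring.
  + have ux : 0 <= u <= x by lra.
    by have := qn_sqr_anti x0 cx0 cx1 c2 ux; lra.
have : S 0 <= S x.
  apply: (@le_of_derive_ge0 S S1 _ _ x0 _ S1_ge0) => u ut.
  have [pu mu] : 0 < c + u < 1 /\ 0 < c - u < 1 by split; lra.
  refine (is_derive1_eq (is_derive1B
    (is_derive1M (is_derive1M (is_derive1C _ _) (is_derive1I _)) (is_derive1C _ _))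
    (is_derive1B (dDr (dK pu)) (dBr (dK mu)))) _).
  by rewrite /S1; ring.
by rewrite /S !addr0 !subr0; lra.
Qed.

(* Squaring twice, with [u t = Iso (c + t) ^+ 2 + t ^+ 2] the claim reduces to
   [(u x - u (- x)) ^+ 2 <= 8 * u 0 * (u x + u (- x) - 2 * u 0)], and both sides
   are compared with [16 * x ^+ 2 * Iso c ^+ 2 * qn c ^+ 2] by [u'' = 2 qn ^+ 2]. *)
Lemma two_point_sym c x (x0 : 0 <= x) (cx0 : 0 < c - x)
    (cx1 : c + x < 1) (c2 : c <= 1 / 2) :
  2 * Iso c <=
  Num.sqrt (Iso (c + x) ^+ 2 + x ^+ 2) + Num.sqrt (Iso (c - x) ^+ 2 + x ^+ 2).
Proof.
have := Iso_sqr_sum x0 cx0 cx1 c2; have := Iso_sqr_diff x0 cx0 cx1 c2; rewrite /K.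
have := Iso_ge0 c.
set m := Iso c; set q := qn c; set Ip := Iso (c + x); set Im := Iso (c - x).
have a0 := sqrtr_ge0 (Ip ^+ 2 + x ^+ 2); have b0 := sqrtr_ge0 (Im ^+ 2 + x ^+ 2).
have ea : Num.sqrt (Ip ^+ 2 + x ^+ 2) ^+ 2 = Ip ^+ 2 + x ^+ 2.
  by rewrite sqr_sqrtr// addr_ge0// sqr_ge0.
have eb : Num.sqrt (Im ^+ 2 + x ^+ 2) ^+ 2 = Im ^+ 2 + x ^+ 2.
  by rewrite sqr_sqrtr// addr_ge0// sqr_ge0.
move: a0 b0 ea eb.
set a := Num.sqrt _; set b := Num.sqrt _ => a0 b0 ea eb m0 /andP[d0 d1] s.
have D : (a ^+ 2 - b ^+ 2) ^+ 2 <= 8 * m ^+ 2 * (a ^+ 2 + b ^+ 2 - 2 * m ^+ 2).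
  have d2 : (a ^+ 2 - b ^+ 2) ^+ 2 <= (4 * x * (m * q)) ^+ 2.
    rewrite -(sqrrN (4 * _ * _)) ler_sqr ?nnegrE; lra.
  apply: (le_trans d2); have m2 := sqr_ge0 m.
  have : 2 * x ^+ 2 * q ^+ 2 <= a ^+ 2 + b ^+ 2 - 2 * m ^+ 2 by lra.
  nra.
rewrite leNgt; apply/negP => ab.
(* The product expands to [16 * m ^+ 4 - 8 * m ^+ 2 * (a ^+ 2 + b ^+ 2) + (a ^+ 2 - b ^+ 2) ^+ 2],
   nonpositive by [D]; yet [|a - b| <= a + b < 2 * m] makes both factors positive. *)
have : (4 * m ^+ 2 - (a + b) ^+ 2) * (4 * m ^+ 2 - (a - b) ^+ 2) <= 0.
  by move: D; rewrite -subr_ge0 => D; rewrite -subr_ge0; apply: le_trans D _; lra.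
apply/negP; rewrite -ltNge; apply: mulr_gt0; nra.
Qed.

Lemma two_point_interior a b : 0 < a < 1 -> 0 < b < 1 ->
  2 * Iso ((a + b) / 2) <=
  Num.sqrt (Iso a ^+ 2 + ((a - b) / 2) ^+ 2)
  + Num.sqrt (Iso b ^+ 2 + ((a - b) / 2) ^+ 2).
Proof.
wlog ab : a b / b <= a.
  move=> H a1 b1; have [ba|ba] := leP b a; first exact: H.
  have := H b a (ltW ba) b1 a1; rewrite [b + a]addrC.
  by rewrite -(sqrrN ((b - a) / 2)) -mulNr opprB [X in _ <= X -> _]addrC.
(* The reflection [p |-> 1 - p] preserves [Iso] and brings the midpoint below [1 / 2], as
   [two_point_sym] requires. *)
wlog c2 : a b ab / (a + b) / 2 <= 1 / 2.
  move=> H a1 b1; have [c2|c2] := leP ((a + b) / 2) (1 / 2); first exact: H.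
  have h := H (1 - b) (1 - a); move: h.
  have -> : (1 - b + (1 - a)) / 2 = 1 - (a + b) / 2 by field.
  have -> : 1 - b - (1 - a) = a - b by ring.
  by rewrite !Iso_sym => h; rewrite [X in _ <= X]addrC; apply: h; lra.
move=> a1 b1; have := @two_point_sym ((a + b) / 2) ((a - b) / 2).
have -> : (a + b) / 2 + (a - b) / 2 = a by field.
have -> : (a + b) / 2 - (a - b) / 2 = b by field.
by apply; lra.
Qed.

Lemma two_point a b : 0 <= a <= 1 -> 0 <= b <= 1 ->
  2 * Iso ((a + b) / 2) <=
  Num.sqrt (Iso a ^+ 2 + ((a - b) / 2) ^+ 2)
  + Num.sqrt (Iso b ^+ 2 + ((a - b) / 2) ^+ 2).
Proof.
move=> a01 b01.
(* Sliding both points towards [1 / 2] makes them interior for [0 < t < 1]; the boundary cases are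
   the limit [t -> 0], by continuity of [Iso]. *)
pose l (u t : R) := (1 - t) * u + t / 2.
pose G t := Num.sqrt (Iso (l a t) ^+ 2 + ((l a t - l b t) / 2) ^+ 2)
  + Num.sqrt (Iso (l b t) ^+ 2 + ((l a t - l b t) / 2) ^+ 2)
  - 2 * Iso ((l a t + l b t) / 2).
have cl u : continuous (l u).
  move=> t; apply: cvgD; last by apply: cvgMl; exact: cvg_id.
  by apply: cvgMl; apply: cvgB; [exact: cvg_cst|exact: cvg_id].
have cI (f : R -> R) : continuous f -> continuous (fun t => Iso (f t)).
  by move=> cf t; apply: continuous_comp; [exact: cf|exact: continuous_Iso].
have c2 (f : R -> R) : continuous f -> continuous (fun t => f t ^+ 2).
  by move=> cf t; exact: (continuous_comp (cf t) (@exprn_continuous R 2 _)).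
have cd : continuous (fun t => ((l a t - l b t) / 2) ^+ 2).
  by apply: c2 => t; apply: cvgMl; apply: cvgB; exact: cl.
have cS (f : R -> R) : continuous f -> continuous (fun t => Num.sqrt (f t)).
  by move=> cf t; exact: (continuous_comp (cf t) (@sqrt_continuous R _)).
have cu u : continuous (fun t => Num.sqrt (Iso (l u t) ^+ 2 + ((l a t - l b t) / 2) ^+ 2)).
  apply: (cS (fun t => Iso (l u t) ^+ 2 + ((l a t - l b t) / 2) ^+ 2)) => t.
  apply: cvgD; last exact: cd.
  exact: (c2 _ (cI _ (cl u))).
have cG : continuous G.
  move=> t; apply: cvgB; first by apply: cvgD; exact: cu.
  apply: cvgMr; apply: (cI (fun t => (l a t + l b t) / 2)) => {}t.
  by apply: cvgMl; apply: cvgD; exact: cl.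
have G0 : G 0 = Num.sqrt (Iso a ^+ 2 + ((a - b) / 2) ^+ 2)
  + Num.sqrt (Iso b ^+ 2 + ((a - b) / 2) ^+ 2) - 2 * Iso ((a + b) / 2).
  by rewrite /G /l subr0 !mul1r mul0r !addr0.
rewrite -subr_ge0 -G0 leNgt; apply/negP => h.
have hn : \forall t \near (0 : R)^'+, G t < 0.
  by apply: cvg_within; exact: (cvgr_lt _ (cG 0) _ h).
have [t [t0 t1 Gt]] : exists t, [/\ 0 < t, t < 1 & G t < 0].
  near (0 : R)^'+ => t; exists t; split; near: t.
  - exact: nbhs_right_gt.
  - exact: nbhs_right_lt.
  - exact: hn.
suff : 0 <= G t by lra.
rewrite /G subr_ge0; apply: two_point_interior; rewrite /l; nra.
Unshelve. all: by end_near. Qed.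

End bobkov_two_point.

(** * Bobkov's inequality for random walks *)

Section walk.
Context {R : realType} {V : zmodType}.
Implicit Types (f g : V -> R) (hs : seq V) (x y h : V).

(** The expectation of [f] at the end of a walk from [x] with steps [h] or [- h], signs fair and
    independent. As iterated averages, induction on [hs] is the tensorisation. *)
Fixpoint walk hs f x : R :=
  if hs is h :: hs' then (walk hs' f (x + h) + walk hs' f (x - h)) / 2 else f x.

Lemma walk_cat s t f x : walk (s ++ t) f x = walk s (walk t f) x.
Proof. by elim: s x => //= h s IH x; rewrite !IH. Qed.

Lemma eq_walk hs f g x : f =1 g -> walk hs f x = walk hs g x.
Proof. by move=> fg; elim: hs x => //= h s IH x; rewrite !IH. Qed.

Lemma walk_cst hs (c : R) x : walk hs (fun=> c) x = c.
Proof. by elim: hs x => //= h s IH x; rewrite !IH; field. Qed.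

Lemma walkZ hs (c : R) f x : walk hs (fun y => c * f y) x = c * walk hs f x.
Proof. by elim: hs x => //= h s IH x; rewrite !IH; field. Qed.

Lemma walkB hs f g x : walk hs (fun y => f y - g y) x = walk hs f x - walk hs g x.
Proof. by elim: hs x => //= h s IH x; rewrite !IH; field. Qed.

Lemma walk_shift hs f c x : walk hs (fun y => f (y + c)) x = walk hs f (x + c).
Proof.
elim: hs x => //= h s IH x; rewrite !IH.
by rewrite (addrAC x h c) (addrAC x (- h) c).
Qed.

Lemma le_walk hs f g x : (forall y, f y <= g y) -> walk hs f x <= walk hs g x.
Proof.
move=> fg; elim: hs x => //= h s IH x.
by rewrite ler_pM2r ?invr_gt0// lerD.
Qed.

Lemma walk_itv hs f x : (forall y, 0 <= f y <= 1) -> 0 <= walk hs f x <= 1.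
Proof.
move=> f01; apply/andP; split.
  by rewrite -(walk_cst hs 0 x); apply: le_walk => y; case/andP: (f01 y).
by rewrite -[leRHS](walk_cst hs 1 x); apply: le_walk => y; case/andP: (f01 y).
Qed.

Lemma walk_dist hs f g x (e : R) : (forall y, `|f y - g y| <= e) ->
  `|walk hs f x - walk hs g x| <= e.
Proof.
move=> fg; rewrite -walkB ler_norml -[X in - X](walk_cst hs e x).
rewrite -[X in _ && (_ <= X)](walk_cst hs e x) -[X in X <= _]sub0r.
rewrite -[X in X - _](walk_cst hs 0 x) -walkB.
by apply/andP; split; apply: le_walk => y; have := fg y; rewrite ler_norml; lra.
Qed.

Lemma sqrt_le (a b : R) : 0 <= b -> a <= b ^+ 2 -> Num.sqrt a <= b.
Proof. by move=> b0 ab; rewrite -[leRHS](ger0_norm b0) -sqrtr_sqr ler_wsqrtr. Qed.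

(** The triangle inequality in the plane; the cross term [uv] is Cauchy-Schwarz, from
    [(a * d - b * c) ^+ 2 >= 0]. *)
Lemma minkowski2 (a b c d : R) :
  Num.sqrt (((a + b) / 2) ^+ 2 + ((c + d) / 2) ^+ 2)
  <= (Num.sqrt (a ^+ 2 + c ^+ 2) + Num.sqrt (b ^+ 2 + d ^+ 2)) / 2.
Proof.
have ea : Num.sqrt (a ^+ 2 + c ^+ 2) ^+ 2 = a ^+ 2 + c ^+ 2.
  by rewrite sqr_sqrtr// addr_ge0// sqr_ge0.
have eb : Num.sqrt (b ^+ 2 + d ^+ 2) ^+ 2 = b ^+ 2 + d ^+ 2.
  by rewrite sqr_sqrtr// addr_ge0// sqr_ge0.
have := sqrtr_ge0 (a ^+ 2 + c ^+ 2); have := sqrtr_ge0 (b ^+ 2 + d ^+ 2).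
move: ea eb; set u := Num.sqrt _; set v := Num.sqrt _ => eu ev v0 u0.
have uv : a * b + c * d <= u * v.
  have [|n0] := leP (a * b + c * d) 0; first by move=> h; nra.
  rewrite -ler_sqr ?nnegrE ?mulr_ge0//; last exact: ltW.
  rewrite exprMn eu ev; have := sqr_ge0 (a * d - b * c); nra.
by apply: sqrt_le; nra.
Qed.

Lemma walk_minkowski hs f g x :
  Num.sqrt (walk hs f x ^+ 2 + walk hs g x ^+ 2)
  <= walk hs (fun y => Num.sqrt (f y ^+ 2 + g y ^+ 2)) x.
Proof.
elim: hs x => //= h s IH x; apply: (le_trans (minkowski2 _ _ _ _)).
by rewrite ler_pM2r ?invr_gt0// lerD.
Qed.

(* [D h y] bounds the discrete derivative of [f] at [y] in the direction [h] on
   both sides; this is the discrete gradient of the hypercube seen from the end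
   point of the walk. *)
Lemma bobkov_walk hs f (D : V -> V -> R) x :
  (forall y, 0 <= f y <= 1) ->
  (forall h y, h \in hs -> `|f y - f (y + (h + h))| <= 2 * D h y) ->
  (forall h y, h \in hs -> `|f y - f (y - (h + h))| <= 2 * D h y) ->
  Iso (walk hs f x)
  <= walk hs (fun y => Num.sqrt (Iso (f y) ^+ 2 + \sum_(h <- hs) D h y ^+ 2)) x.
Proof.
move=> f01; elim: hs x => [|h s IH] x Dp Dm /=.
  by rewrite big_nil addr0 sqrtr_sqr ger0_norm// Iso_ge0.
have sub k : k \in s -> k \in h :: s by rewrite inE => ->; rewrite orbT.
have {}IH y : Iso (walk s f y) <= _ := IH y
  (fun k z ks => Dp k z (sub k ks)) (fun k z ks => Dm k z (sub k ks)).
have Dh y : 0 <= D h y.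
  by have := Dp h y (mem_head _ _); have := normr_ge0 (f y - f (y + (h + h))); lra.
set N := fun y => Num.sqrt (_ + \sum_(k <- s) _) in IH.
have NE y : Num.sqrt (Iso (f y) ^+ 2 + \sum_(k <- h :: s) D k y ^+ 2)
    = Num.sqrt (N y ^+ 2 + D h y ^+ 2).
  rewrite /N big_cons sqr_sqrtr ?addr_ge0 ?sqr_ge0 ?sumr_ge0//.
    by rewrite -addrA [D h y ^+ 2 + _]addrC.
  by move=> k _; exact: sqr_ge0.
rewrite !(eq_walk _ _ NE).
set mp := walk s f (x + h); set mm := walk s f (x - h).
(* The difference of the two means is a mean of discrete derivatives, seen backwards from [x + h]
   here and forwards from [x - h] in [fp]. The two-point inequality needs a bound at each of these
   points, hence the two hypotheses on [D]. *)
have fm : mp - mm = walk s (fun y => f y - f (y - (h + h))) (x + h).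
  by rewrite walkB walk_shift /mp /mm opprD addrA addrK.
have fp : mm - mp = walk s (fun y => f y - f (y + (h + h))) (x - h).
  by rewrite walkB walk_shift /mp /mm addrA subrK.
have hp : `|(mp - mm) / 2| <= walk s (D h) (x + h).
  rewrite normrM [`|2^-1|]gtr0_norm ?invr_gt0// ler_pdivrMr// mulrC -walkZ fm.
  by rewrite ler_norml -mulN1r -walkZ; apply/andP; split; apply: le_walk => y;
    have := Dm h y (mem_head _ _); rewrite ler_norml; lra.
have hm : `|(mp - mm) / 2| <= walk s (D h) (x - h).
  rewrite normrM [`|2^-1|]gtr0_norm ?invr_gt0// ler_pdivrMr// mulrC -walkZ.
  rewrite distrC fp.
  by rewrite ler_norml -mulN1r -walkZ; apply/andP; split; apply: le_walk => y;
    have := Dp h y (mem_head _ _); rewrite ler_norml; lra.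
(* One branch of the two-point inequality: [IH] bounds the profile, [hy] the increment, and
   Minkowski pulls the square root under the walk. *)
have step y : `|(mp - mm) / 2| <= walk s (D h) y ->
    Num.sqrt (Iso (walk s f y) ^+ 2 + ((mp - mm) / 2) ^+ 2)
    <= walk s (fun z => Num.sqrt (N z ^+ 2 + D h z ^+ 2)) y.
  move=> hy; apply: le_trans (walk_minkowski _ _ _ _); apply: ler_wsqrtr.
  apply: lerD.
    by rewrite ler_sqr ?nnegrE ?Iso_ge0// (le_trans _ (IH y))// Iso_ge0.
  rewrite -(real_normK (num_real _)) ler_sqr ?nnegrE//.
  exact: le_trans hy.
rewrite ler_pdivlMr// mulrC; apply: le_trans (lerD (step _ hp) (step _ hm)).
by apply: two_point; apply: walk_itv.
Qed.

End walk.

Lemma walk_map {R : realType} {V W : zmodType} (A B : V -> W) (hs : seq V)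
    (f : W -> R) x :
  (forall y h, A (y + h) = A y + B h) -> (forall y h, A (y - h) = A y - B h) ->
  walk (map B hs) f (A x) = walk hs (fun y => f (A y)) x.
Proof. by move=> Ap Am; elim: hs x => //= h s IH x; rewrite -!IH Ap Am. Qed.

(** * A smooth approximation of the distance to a finite set *)

Section softmin.
Context {R : realType}.

(** From [exp y <= 1 / (1 - y)] and [(1 + y + 2 * y ^+ 2) * (1 - y) = 1 + y ^+ 2 * (1 - 2 * y)],
    which explains the range [y <= 1 / 2]. *)
Lemma expR_le_quad (y : R) : y <= 1 / 2 -> expR y <= 1 + y + 2 * y ^+ 2.
Proof.
move=> y2; have h := expR_ge1Dx (- y).
have e : expR y * expR (- y) = 1 by exact: expRxMexpNx_1.
have y0 := expR_gt0 y.
have h1 : expR y * (1 - y) <= 1 by rewrite -[leRHS]e ler_pM2l.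
have h2 : 1 <= (1 + y + 2 * y ^+ 2) * (1 - y) by have := sqr_ge0 y; nra.
have p : 0 < 1 - y by lra.
by rewrite -(ler_pM2r p); exact: le_trans h1 h2.
Qed.

Variables (n : nat) (b : R).
Hypothesis b0 : 0 < b.
Implicit Types r s : 'I_n.+1 -> R.

(** The log-sum-exp minimum at inverse temperature [b]: it lies below the true minimum by at most
    [b^-1 * ln n.+1]. *)
Definition softmin r : R := - b^-1 * ln (\sum_k expR (- (b * r k))).

Let Z r := \sum_k expR (- (b * r k)).

Let Z_gt0 r : 0 < Z r.
Proof.
rewrite /Z big_ord_recl ltr_pwDl ?expR_gt0//.
by apply: sumr_ge0 => k _; exact: expR_ge0.
Qed.

(** The gradient of [softmin]. It is a probability vector, so Lipschitz and gradient bounds common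
    to the [r k] pass to [softmin]. *)
Definition gibbs r k : R := expR (- (b * r k)) / \sum_k expR (- (b * r k)).

Lemma gibbs_ge0 r k : 0 <= gibbs r k.
Proof. by rewrite divr_ge0 ?expR_ge0// ltW// Z_gt0. Qed.

Lemma gibbs_sum r : \sum_k gibbs r k = 1.
Proof. by rewrite -mulr_suml divff// gt_eqF// Z_gt0. Qed.

Lemma softminB r s : softmin s - softmin r =
  - b^-1 * ln (\sum_k gibbs r k * expR (- (b * (s k - r k)))).
Proof.
rewrite /softmin -mulrBr -ln_div ?posrE ?Z_gt0//; congr (_ * ln _).
rewrite mulr_suml; apply: eq_bigr => k _; rewrite /gibbs mulrAC -expRD.
by congr (expR _ / _); ring.
Qed.

Lemma gibbs_expR_gt0 r (y : 'I_n.+1 -> R) : 0 < \sum_k gibbs r k * expR (y k).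
Proof.
rewrite big_ord_recl ltr_pwDl//.
  by rewrite mulr_gt0 ?expR_gt0// divr_gt0 ?expR_gt0 ?Z_gt0.
by apply: sumr_ge0 => k _; rewrite mulr_ge0 ?expR_ge0 ?gibbs_ge0.
Qed.

(** Jensen's inequality under the weights [gibbs r], proved with the tangent of [exp] at the mean
    [m]: the concave [softmin] lies below its tangent. *)
Lemma softmin_le r s : softmin s - softmin r <= \sum_k gibbs r k * (s k - r k).
Proof.
rewrite softminB mulNr lerNl ler_pdivlMl// mulrN mulr_sumr -sumrN.
set m := \sum_k _.
have jensen : expR m <= \sum_k gibbs r k * expR (- (b * (s k - r k))).
  rewrite -[leLHS]mulr1.
  have -> : 1 = \sum_k gibbs r k * (1 + (- (b * (s k - r k)) - m)).
    transitivity (\sum_k gibbs r k + (m - (\sum_k gibbs r k) * m)).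
      by rewrite gibbs_sum mul1r subrr addr0.
    rewrite mulr_suml -sumrB -big_split/=; apply: eq_bigr => k _; ring.
  rewrite mulr_sumr; apply: ler_sum => k _.
  rewrite mulrCA ler_wpM2l ?gibbs_ge0//.
  rewrite -[X in _ <= expR X](subrKC m) addrC expRD ler_pM2l ?expR_gt0//.
  by rewrite addrC; exact: expR_ge1Dx.
rewrite -[leLHS]expRK ler_ln ?posrE ?expR_gt0 ?gibbs_expR_gt0//.
Qed.

(** [ln u <= u - 1] and [expR_le_quad], at arguments of size at most [b * c], leave the remainder
    [2 * (b * c) ^+ 2 / b]. *)
Lemma softmin_ge r s c : b * c <= 1 / 2 -> (forall k, `|s k - r k| <= c) ->
  \sum_k gibbs r k * (s k - r k) - 2 * b * c ^+ 2 <= softmin s - softmin r.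
Proof.
move=> bc src; rewrite softminB mulNr lerNr ler_pdivrMl//.
apply: (le_trans (_ : _ <= \sum_k gibbs r k * expR (- (b * (s k - r k))) - 1)).
  by have := expR_ge1Dx (ln (\sum_k gibbs r k * expR (- (b * (s k - r k)))));
     rewrite lnK ?posrE ?gibbs_expR_gt0//; lra.
rewrite lerBlDr; apply: (le_trans (_ : _ <= \sum_k gibbs r k *
   (1 + - (b * (s k - r k)) + 2 * (b * c) ^+ 2))).
  apply: ler_sum => k _; rewrite ler_wpM2l ?gibbs_ge0//.
  have := src k; rewrite ler_norml => /andP[h1 h2].
  apply: le_trans (expR_le_quad _) _; first by have hb := b0; nra.
  rewrite lerD2l sqrrN ler_pM2l// !exprMn ler_pM2l ?exprn_gt0//.
  by rewrite -real_normK ?num_real// ler_sqr ?nnegrE// (le_trans _ (src k)).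
have -> : \sum_k gibbs r k * (1 + - (b * (s k - r k)) + 2 * (b * c) ^+ 2) =
   \sum_k gibbs r k - b * (\sum_k gibbs r k * (s k - r k))
   + (\sum_k gibbs r k) * (2 * (b * c) ^+ 2).
  rewrite mulr_sumr mulr_suml -sumrB -big_split/=.
  by apply: eq_bigr => k _; ring.
by rewrite gibbs_sum exprMn; lra.
Qed.

Lemma softmin_lip r s c : (forall k, `|s k - r k| <= c) ->
  `|softmin s - softmin r| <= c.
Proof.
have H u v : (forall k, `|u k - v k| <= c) -> softmin u - softmin v <= c.
  move=> h; apply: le_trans (softmin_le _ _) _.
  rewrite -[leRHS]mul1r -(gibbs_sum v) mulr_suml; apply: ler_sum => k _.
  by rewrite ler_wpM2l ?gibbs_ge0//; apply: le_trans (ler_norm _) (h k).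
move=> h; rewrite ler_norml lerNl opprB !H// => k; by rewrite distrC.
Qed.

Lemma softmin_ub r k : softmin r <= r k.
Proof.
rewrite /softmin mulNr lerNl ler_pdivlMl// mulrN -[leLHS]expRK.
rewrite ler_ln ?posrE ?expR_gt0//; last exact: Z_gt0.
rewrite (bigD1 k)//= lerDl; apply: sumr_ge0 => i _; exact: expR_ge0.
Qed.

Lemma softmin_lb r c : (forall k, c <= r k) -> c - b^-1 * ln n.+1%:R <= softmin r.
Proof.
move=> cr; rewrite /softmin.
have S : ln (\sum_k expR (- (b * r k))) <= ln n.+1%:R - b * c.
  rewrite -[X in _ - X](opprK) opprK -[- (b * c)]expRK -lnM ?posrE ?ltr0n ?expR_gt0//.
  rewrite ler_ln ?posrE ?Z_gt0 ?mulr_gt0 ?expR_gt0 ?ltr0n//.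
  apply: (le_trans (_ : _ <= \sum_(k < n.+1) expR (- (b * c)))).
    by apply: ler_sum => k _; rewrite ler_expR lerN2 ler_pM2l.
  by rewrite sumr_const card_ord mulr_natl.
have : b^-1 * ln (\sum_k expR (- (b * r k))) <= b^-1 * (ln n.+1%:R - b * c).
  by rewrite ler_pM2l ?invr_gt0.
rewrite mulrBr mulKf ?gt_eqF//; lra.
Qed.

End softmin.

(** * The smoothed norm and the distance built from it *)

Section smooth_distance.
Context {R : realType} {d : nat}.
Implicit Types (x v : 'rV[R]_d) (i : 'I_d).

(** Adding [eta ^+ 2] under the root removes the kink at [0]: second-order remainders become of
    order [1 / eta] everywhere. *)
Definition smooth_norm (eta : R) v : R :=
  Num.sqrt (\sum_i v ord0 i ^+ 2 + eta ^+ 2).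

Lemma enorm_le_smooth eta v : enorm v <= smooth_norm eta v.
Proof. by apply: ler_wsqrtr; rewrite lerDl sqr_ge0. Qed.

Lemma smooth_norm_le eta v : 0 <= eta -> smooth_norm eta v <= enorm v + eta.
Proof.
move=> e0; have s0 : 0 <= \sum_i v ord0 i ^+ 2 by apply: sumr_ge0 => i _; exact: sqr_ge0.
apply: sqrt_le; first by rewrite addr_ge0// sqrtr_ge0.
rewrite sqrrD /enorm sqr_sqrtr// -addrA lerD2l lerDr.
by rewrite mulrn_wge0// mulr_ge0// sqrtr_ge0.
Qed.

Lemma smooth_norm_gt0 eta v : 0 < eta -> eta <= smooth_norm eta v.
Proof.
move=> e0; apply: (le_trans (_ : _ <= Num.sqrt (eta ^+ 2))).
  by rewrite sqrtr_sqr ler_norm.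
apply: ler_wsqrtr; rewrite lerDr.
by apply: sumr_ge0 => i _; exact: sqr_ge0.
Qed.

Lemma smooth_norm_sqr eta v :
  smooth_norm eta v ^+ 2 = \sum_i v ord0 i ^+ 2 + eta ^+ 2.
Proof.
rewrite sqr_sqrtr// addr_ge0 ?sqr_ge0//.
by apply: sumr_ge0 => i _; exact: sqr_ge0.
Qed.

Lemma coord_le_smooth eta v i : `|v ord0 i| <= smooth_norm eta v.
Proof.
rewrite -sqrtr_sqr; apply: ler_wsqrtr.
rewrite (bigD1 i)//= -addrA lerDl addr_ge0 ?sqr_ge0//.
by apply: sumr_ge0 => j _; exact: sqr_ge0.
Qed.

Let step i (t : R) : 'rV[R]_d := t *: delta_mx ord0 i.

Let stepE v i t j : (v + step i t) ord0 j = v ord0 j + (if j == i then t else 0).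
Proof. by rewrite !mxE eqxx/=; case: eqP; rewrite ?mulr1 ?mulr0. Qed.

Let step_sqr eta v i t : smooth_norm eta (v + step i t) ^+ 2 =
  smooth_norm eta v ^+ 2 + 2 * t * v ord0 i + t ^+ 2.
Proof.
rewrite !smooth_norm_sqr (bigD1 i)//= [in RHS](bigD1 i)//= stepE eqxx.
rewrite (eq_bigr (fun j => v ord0 j ^+ 2)); first by ring.
by move=> j /negbTE ji; rewrite stepE ji addr0.
Qed.

Lemma smooth_norm_lip eta v i t : 0 < eta ->
  `|smooth_norm eta (v + step i t) - smooth_norm eta v| <= `|t|.
Proof.
move=> e0; have e1 := step_sqr eta v i t.
have := smooth_norm_gt0 v e0; have := smooth_norm_gt0 (v + step i t) e0.
have := coord_le_smooth eta v i; have := coord_le_smooth eta (v + step i t) i.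
rewrite stepE eqxx; move: e1.
set r' := smooth_norm _ (_ + _); set r := smooth_norm _ v; set w := v ord0 i.
move=> e1; rewrite !ler_norml => /andP[h1 h2] /andP[h3 h4] h5 h6.
have e2 : (r' - r) * (r' + r) = t * (w + (w + t)) by rewrite -subr_sqr e1; ring.
have p : 0 < r' + r by lra.
have : `|r' - r| * (r' + r) <= `|t| * (r' + r).
  rewrite -{1}(gtr0_norm p) -normrM e2 normrM ler_wpM2l// ler_norml; lra.
by rewrite ler_pM2r// ler_norml.
Qed.

Lemma smooth_norm_diff eta v i t : 0 < eta ->
  `|smooth_norm eta (v + step i t) - smooth_norm eta v
     - t * (v ord0 i / smooth_norm eta v)| <= t ^+ 2 / eta.
Proof.
move=> e0; have e1 := step_sqr eta v i t.
have := smooth_norm_gt0 v e0; have := smooth_norm_gt0 (v + step i t) e0.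
have := coord_le_smooth eta v i; have := smooth_norm_lip v i t e0; move: e1.
set r' := smooth_norm _ (_ + _); set r := smooth_norm _ v; set w := v ord0 i.
move=> e1 dr wr h1 h2.
have r0 : 0 < r by lra.
have p : 0 < r * (r' + r) by rewrite mulr_gt0//; lra.
have e2 : (r' - r) * (r' + r) = t * (2 * w + t) by rewrite -subr_sqr e1; ring.
(* Over the denominator [r * (r' + r)], the bounds [|w| <= r] and [|r' - r| <= |t|] keep the
   numerator below [2 * t ^+ 2 * r], while [r' + r >= 2 * eta]. *)
have e3 : (r' - r - t * (w / r)) * (r * (r' + r)) = t * (w * (r - r') + t * r).
  have -> : (r' - r - t * (w / r)) * (r * (r' + r)) =
    r * ((r' - r) * (r' + r)) - t * w * (r' + r) by field; lra.
  by rewrite e2; ring.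
have h3 : `|r' - r - t * (w / r)| * (r * (r' + r)) <= `|t| * (2 * `|t| * r).
  rewrite -{1}(gtr0_norm p) -normrM e3 normrM ler_wpM2l//.
  apply: le_trans (ler_normD _ _) _; rewrite !normrM (gtr0_norm r0) distrC.
  have := ler_pM (normr_ge0 w) (normr_ge0 (r' - r)) wr dr; lra.
rewrite ler_pdivlMr// -(ler_pM2r p) mulrAC.
apply: (le_trans (_ : _ <= (`|t| * (2 * `|t| * r)) * eta)); first by rewrite ler_pM2r.
have -> : `|t| * (2 * `|t| * r) * eta = `|t| ^+ 2 * (r * (2 * eta)) by ring.
rewrite real_normK ?num_real// ler_wpM2l ?sqr_ge0// ler_pM2l//; lra.
Qed.

(* [F] is the softmin of the functions [smooth_norm k (x - a j)]; its second
   order remainder only involves the Gibbs average [g] of their gradients. *)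
Lemma smooth_distance n (a : 'I_n.+1 -> 'rV[R]_d) (k : R) : 0 < k ->
  exists (F : 'rV[R]_d -> R) (g : 'rV[R]_d -> 'I_d -> R) (C t0 : R),
  [/\ 0 <= C /\ 0 < t0,
      forall x i t, `|F (x + t *: delta_mx ord0 i) - F x| <= `|t|,
      forall x, \sum_i g x i ^+ 2 <= 1 /\
        forall i t, `|t| <= t0 ->
          `|F (x + t *: delta_mx ord0 i) - F x - t * g x i| <= C * t ^+ 2,
      forall x rho j, enorm (x - a j) < rho -> F x < rho + k
    & forall x rho, F x < rho -> exists j, enorm (x - a j) < rho + k].
Proof.
move=> k0; pose b := ln n.+1%:R / k + 1 : R.
have ln0 : 0 <= ln n.+1%:R :> R by rewrite ln_ge0// ler1n.
have b0 : 0 < b by rewrite ltr_wpDl// divr_ge0// ltW.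
pose r x (j : 'I_n.+1) := smooth_norm k (x - a j).
pose F x := softmin b (r x).
pose u x j i := (x - a j) ord0 i / r x j.
have rst x i t j : r (x + step i t) j = smooth_norm k (x - a j + step i t).
  by rewrite /r addrAC.
have rgt0 x j : 0 < r x j by apply: lt_le_trans (smooth_norm_gt0 _ k0).
exists F, (fun x i => \sum_j gibbs b (r x) j * u x j i).
(* In [C], [2 * b] comes from [softmin_ge] and [k^-1] from [smooth_norm_diff] with [eta = k]; [t0]
   ensures [b * |t| <= 1 / 2]. *)
exists (2 * b + k^-1), (2 * b)^-1; split.
- by split; [rewrite addr_ge0 ?mulr_ge0 ?invr_ge0// ltW|rewrite invr_gt0 mulr_gt0].
- move=> x i t; apply: softmin_lip => // j.
  by rewrite rst; exact: smooth_norm_lip.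
- move=> x; split.
    (* Nonnegativity of the variance under the Gibbs weights reduces the claim to the gradient of a
       single smoothed norm. *)
    apply: (le_trans (_ : _ <= \sum_i \sum_j gibbs b (r x) j * u x j i ^+ 2)).
      apply: ler_sum => i _; set m := \sum_j _.
      have : 0 <= \sum_j gibbs b (r x) j * (u x j i - m) ^+ 2.
        by apply: sumr_ge0 => j _; rewrite mulr_ge0 ?sqr_ge0 ?gibbs_ge0.
      have -> : \sum_j gibbs b (r x) j * (u x j i - m) ^+ 2 =
        \sum_j gibbs b (r x) j * u x j i ^+ 2 - (2 * m) * m
        + (\sum_j gibbs b (r x) j) * m ^+ 2.
        rewrite {3}/m mulr_sumr mulr_suml -sumrB -big_split/=.
        by apply: eq_bigr => j _; ring.
      by rewrite gibbs_sum; lra.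
    rewrite exchange_big/= -[leRHS](gibbs_sum b (r x)); apply: ler_sum => j _.
    rewrite -mulr_sumr ler_piMr ?gibbs_ge0//.
    under eq_bigr do rewrite exprMn exprVn.
    rewrite -mulr_suml ler_pdivrMr ?exprn_gt0// mul1r smooth_norm_sqr.
    by rewrite lerDl sqr_ge0.
  move=> i t tt0.
  have bt : b * `|t| <= 1 / 2.
    have := ler_wpM2l (ltW b0) tt0; rewrite invfM mulrCA divff ?gt_eqF//.
    by rewrite mulr1 mul1r.
  have lip j : `|r (x + step i t) j - r x j| <= `|t|.
    by rewrite rst; exact: smooth_norm_lip.
  have := softmin_ge b0 bt lip; have := softmin_le b0 (r x) (r (x + step i t)).
  rewrite real_normK ?num_real// -/(F x) -/(F (x + step i t)).
  set S := \sum_j _.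
  have : `|S - t * \sum_j gibbs b (r x) j * u x j i| <= t ^+ 2 / k.
    rewrite mulr_sumr -sumrB; apply: le_trans (ler_norm_sum _ _ _) _.
    rewrite -[leRHS]mul1r -(gibbs_sum b (r x)) mulr_suml; apply: ler_sum => j _.
    rewrite mulrCA -mulrBr normrM ger0_norm ?gibbs_ge0// ler_wpM2l ?gibbs_ge0//.
    by rewrite rst; exact: smooth_norm_diff.
  rewrite /step !ler_norml; set fx := F (x + _); set T := t * _.
  move=> /andP[h1 h2] h3 h4; rewrite mulrDl mulrC; have := sqr_ge0 t.
  have := mulr_ge0 (ltW b0) (sqr_ge0 t).
  move: h1 h2; rewrite mulrC; lra.
- move=> x rho j xj; apply: le_lt_trans (softmin_ub _ _ j) _ => //.
  by apply: le_lt_trans (smooth_norm_le _ (ltW k0)) _; rewrite ltrD2r.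
- move=> x rho Fx; apply: contrapT => /forallNP h.
  suff : rho <= F x by rewrite leNgt Fx.
  apply: le_trans (softmin_lb b0 (c := rho + k) _).
    rewrite -addrA lerDl subr_ge0 ler_pdivrMl// /b mulrDl divfK ?gt_eqF//.
    by rewrite mul1r lerDl ltW.
  move=> j; apply: le_trans (enorm_le_smooth _ _).
  by rewrite leNgt; apply/negP; exact: h.
Qed.

End smooth_distance.

(** * Central limit theorem with a rate *)

Section gaussian_combinations.
Context {R : realType}.
Implicit Types (m v y : R) (F : R -> R) (l : seq (R * (R * R))).
Notation mu := (@lebesgue_measure R).

(** Parametrised by the variance, which a step of the walk increases by [h ^+ 2]. *)
Definition pd m v y : R := normal_pdf m (Num.sqrt v) y.

Lemma pdE m v y : 0 < v ->
  pd m v y = (Num.sqrt (v * (pi *+ 2)))^-1 * expR (- ((y - m) ^+ 2 / (2 * v))).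
Proof.
move=> v0; rewrite /pd normal_pdfE ?sqrtr_eq0 -?ltNge// /normal_peak /normal_fun.
rewrite sqr_sqrtr ?ltW//; congr ((Num.sqrt _)^-1 * expR _).
  by rewrite (mulrnAr v pi 2).
by rewrite mulNr [2 * v]mulr_natl.
Qed.

Lemma pd_ge0 m v y : 0 <= pd m v y. Proof. exact: normal_pdf_ge0. Qed.

Lemma pd_gt0 m v y : 0 < v -> 0 < pd m v y.
Proof.
by move=> v0; rewrite pdE// mulr_gt0 ?expR_gt0// invr_gt0 sqrtr_gt0 mulr_gt0//
  mulrn_wgt0// pi_gt0.
Qed.

Lemma measurable_pd m v : measurable_fun setT (pd m v).
Proof. exact: measurable_normal_pdf. Qed.

(** An entry [(c, (m, v))] stands for [c] times the density of mean [m] and variance [v], so the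
    integral is the sum of the weights alone. *)
Definition comb l y : R := \sum_(p <- l) p.1 * pd p.2.1 p.2.2 y.

Definition gint F m v : R := \int[mu]_y (F y * pd m v y).

Lemma integrable_pd m v : mu.-integrable setT (EFin \o pd m v).
Proof. exact: integrable_normal_pdf. Qed.

Lemma integrable_Fpd F m v (M : R) : measurable_fun setT F ->
  (forall y, `|F y| <= M) -> mu.-integrable setT (EFin \o (fun y => F y * pd m v y)).
Proof.
move=> mF FM.
apply: (@le_integrable _ _ _ mu _ measurableT _ (EFin \o (fun y => M * pd m v y))).
- apply/measurable_EFinP; apply: measurable_funM => //; exact: measurable_pd.
- move=> y _ /=; rewrite lee_fin !normrM ler_wpM2r//.
  by rewrite (le_trans (FM y))// ler_norm.
- rewrite (_ : _ \o _ = (fun y => M%:E * (pd m v y)%:E)%E).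
    by apply: integrableZl => //; exact: integrable_pd.
  by apply/funext => y; rewrite /= EFinM.
Qed.

Lemma comb_cons p l y : comb (p :: l) y = p.1 * pd p.2.1 p.2.2 y + comb l y.
Proof. by rewrite /comb big_cons. Qed.

Lemma integral_Fcomb F l (M : R) : measurable_fun setT F ->
  (forall y, `|F y| <= M) ->
  mu.-integrable setT (EFin \o (fun y => F y * comb l y)) /\
  \int[mu]_y (F y * comb l y) = \sum_(p <- l) p.1 * gint F p.2.1 p.2.2.
Proof.
move=> mF FM; elim: l => [|p l [i1 i2]].
  have -> : (fun y => F y * comb [::] y) = cst 0.
    by apply/funext => y; rewrite /comb big_nil mulr0.
  rewrite big_nil; split; last by rewrite Rintegral_cst// mul0r.
  exact: integrable0.
have ip := @integrable_Fpd F p.2.1 p.2.2 M mF FM.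
have E : (fun y => F y * comb (p :: l) y) =
   (fun y => p.1 * (F y * pd p.2.1 p.2.2 y) + F y * comb l y).
  by apply/funext => y; rewrite comb_cons; ring.
have ip1 : mu.-integrable setT (EFin \o (fun y => p.1 * (F y * pd p.2.1 p.2.2 y))).
  rewrite (_ : _ \o _ = (fun y => p.1%:E * (F y * pd p.2.1 p.2.2 y)%:E)%E).
    exact: integrableZl.
  by apply/funext => y; rewrite /= EFinM.
rewrite E big_cons; split; last first.
  by rewrite RintegralD// RintegralZl// i2.
rewrite (_ : _ \o _ = ((EFin \o (fun y => p.1 * (F y * pd p.2.1 p.2.2 y))%R)
  \+ (EFin \o (fun y => F y * comb l y)%R))%E); first exact: integrableD.
by apply/funext => y.
Qed.

Lemma gint1 m v : gint (fun=> 1) m v = 1.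
Proof.
rewrite /gint; under eq_Rintegral do rewrite mul1r.
by rewrite /Rintegral integral_normal_pdf.
Qed.

Lemma integral_comb l :
  mu.-integrable setT (EFin \o comb l) /\ \int[mu]_y comb l y = \sum_(p <- l) p.1.
Proof.
have [|y|] := @integral_Fcomb (fun=> 1) l 1; rewrite ?normr1//.
rewrite (_ : (fun y => 1 * comb l y) = comb l); last by apply/funext => y; rewrite mul1r.
by move=> i ->; split => //; apply: eq_bigr => p _; rewrite gint1 mulr1.
Qed.

(** All the estimates on [gint] below pass through this: a pointwise bound by a combination of
    densities integrates to the sum of its weights. *)
Lemma gint_comb_dist F l1 l2 l3 (M : R) : measurable_fun setT F ->
  (forall y, `|F y| <= M) ->
  (forall y, `|F y * comb l1 y - comb l3 y| <= comb l2 y) ->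
  `|\sum_(p <- l1) p.1 * gint F p.2.1 p.2.2 - \sum_(p <- l3) p.1|
    <= \sum_(p <- l2) p.1.
Proof.
move=> mF FM h.
have [i1 <-] := @integral_Fcomb F l1 M mF FM.
have [i2 <-] := integral_comb l2; have [i3 <-] := integral_comb l3.
rewrite -RintegralB//.
have i13 : mu.-integrable setT (EFin \o (fun y => F y * comb l1 y - comb l3 y)).
  rewrite (_ : _ \o _ = ((EFin \o (fun y => F y * comb l1 y)%R) \- (EFin \o comb l3))%E).
    exact: integrableB.
  by apply/funext => y.
apply: le_trans (le_normr_Rintegral _ i13) _ => //.
apply: le_Rintegral => //.
by have := integrable_norm i13.
Qed.

Let gauss_ratio (c a b e : R) : c != 0 ->
  (c * expR a) * (c * expR b) / (c * expR e) = c * expR (a + b - e).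
Proof. by move=> c0; rewrite !expRD expRN; have := expR_gt0 e => h; field; lra. Qed.

Let peak_gt0 v : 0 < v -> 0 < (Num.sqrt (v * (pi *+ 2)))^-1 :> R.
Proof. by move=> v0; rewrite invr_gt0 sqrtr_gt0 mulr_gt0// mulrn_wgt0// pi_gt0. Qed.

(** Completing the square: the product of two such densities over a third is again a multiple of a
    normal density. This and the next three identities evaluate the chi-square terms. *)
Lemma pd_shift_sqr x v h y : 0 < v ->
  pd (x + h) v y * pd (x + h) v y / pd x v y
  = expR (h ^+ 2 / v) * pd (x + 2 * h) v y.
Proof.
move=> v0; rewrite !pdE// gauss_ratio ?gt_eqF ?peak_gt0// mulrCA -expRD.
by congr (_ * expR _); field; rewrite gt_eqF.
Qed.

Lemma pd_shift_cross x v h y : 0 < v ->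
  pd (x + h) v y * pd (x - h) v y / pd x v y = expR (- (h ^+ 2 / v)) * pd x v y.
Proof.
move=> v0; rewrite !pdE// gauss_ratio ?gt_eqF ?peak_gt0// mulrCA -expRD.
by congr (_ * expR _); field; rewrite gt_eqF.
Qed.

Lemma pd_shift_wide x v h y : 0 < v -> let t := h ^+ 2 / v in
  pd (x + h) v y * pd x (v * (1 + t)) y / pd x v y
  = expR (t ^+ 2 / 2) * pd (x + h * (1 + t)) (v * (1 + t)) y.
Proof.
move=> v0 t; have t0 : 0 <= t by rewrite divr_ge0 ?sqr_ge0// ltW.
have w0 : 0 < v * (1 + t) by rewrite mulr_gt0//; lra.
rewrite !(pdE _ _ w0) !(pdE _ _ v0).
have := peak_gt0 v0; set c := (_)^-1 => c0.
set c' := (Num.sqrt (v * (1 + t) * _))^-1.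
have -> : forall a b e, c * expR a * (c' * expR b) / (c * expR e) =
    c' * expR (a + b - e).
  by move=> a b e; rewrite !expRD expRN; have := expR_gt0 e => h1; field; lra.
rewrite [RHS]mulrCA -expRD; congr (_ * expR _); rewrite /t; field.
rewrite gt_eqF//=; have : 0 <= h ^+ 2 by exact: sqr_ge0.
by move=> h2; apply/negP => /eqP e; nra.
Qed.

(** With [w = v * (1 + t)], [2 / w - 1 / v = (1 - t) / w] is the inverse of the new variance,
    positive because [t < 1]. *)
Lemma pd_wide_sqr x v t y : 0 < v -> 0 <= t < 1 ->
  pd x (v * (1 + t)) y * pd x (v * (1 + t)) y / pd x v y
  = (Num.sqrt (1 - t ^+ 2))^-1 * pd x (v * (1 + t) / (1 - t)) y.
Proof.
move=> v0 t01.
have w0 : 0 < v * (1 + t) by rewrite mulr_gt0//; lra.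
have s0 : 0 < v * (1 + t) / (1 - t) by rewrite divr_gt0//; lra.
have k0 : 0 < 1 - t ^+ 2 by nra.
have P0 : 0 < pi *+ 2 :> R by rewrite mulrn_wgt0// pi_gt0.
rewrite !(pdE _ _ w0) (pdE _ _ v0) (pdE _ _ s0).
set P := pi *+ 2 in P0 *; set w := v * (1 + t) in w0 s0 *.
set A := Num.sqrt (w * P); set B := Num.sqrt (v * P).
set S := Num.sqrt (w / (1 - t) * P); set K := Num.sqrt (1 - t ^+ 2).
have A0 : 0 < A by rewrite sqrtr_gt0 mulr_gt0.
have B0 : 0 < B by rewrite sqrtr_gt0 mulr_gt0.
have S0 : 0 < S by rewrite sqrtr_gt0 mulr_gt0.
have K0 : 0 < K by rewrite sqrtr_gt0.
have E : B * S * K = A * A.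
  have -> : A * A = w * P by rewrite -expr2 sqr_sqrtr// mulr_ge0// ltW.
  have vP : 0 <= v * P by rewrite mulr_ge0// ltW.
  have sP : 0 <= w / (1 - t) * P by rewrite mulr_ge0// ltW.
  have -> : B * S * K = Num.sqrt (v * P * (w / (1 - t) * P) * (1 - t ^+ 2)).
    rewrite (@sqrtrM _ _ (1 - t ^+ 2)); last by rewrite mulr_ge0.
    by rewrite (@sqrtrM _ _ (w / (1 - t) * P)).
  have -> : v * P * (w / (1 - t) * P) * (1 - t ^+ 2) = (w * P) ^+ 2.
    by rewrite /w; field; lra.
  by rewrite sqrtr_sqr gtr0_norm// mulr_gt0.
have -> : forall a b, A^-1 * expR a * (A^-1 * expR a) / (B^-1 * expR b) =
    K^-1 * (S^-1 * expR (a + a - b)).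
  move=> a b; rewrite !expRD expRN; have := expR_gt0 b => h1.
  have -> : K^-1 * (S^-1 * (expR a * expR a / expR b)) =
    B / (B * S * K) * (expR a * expR a / expR b) by field; lra.
  by rewrite E; field; lra.
congr (_ * (_ * expR _)); rewrite /w; field.
by rewrite !gt_eqF//=; lra.
Qed.

Lemma sinh_le (t : R) : 0 <= t -> expR t - expR (- t) <= t * (expR t + expR (- t)).
Proof.
move=> t0.
have dN (u : R) : is_derive u 1 (fun u => expR (- u)) (- expR (- u)).
  refine (is_derive1_eq (is_derive1O (is_derive_expR _) (is_derive1N (is_derive1I _))) _).
  by rewrite mulrN1.
have := @le_of_derive_ge0 R (fun u => u * (expR u + expR (- u)) - (expR u - expR (- u)))
  (fun u => u * (expR u - expR (- u))) 0 t t0.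
rewrite mul0r oppr0 expR0 subrr subr0 subr_ge0; apply => u /andP[u0 _].
  refine (is_derive1_eq (is_derive1B (is_derive1M (is_derive1I _)
    (is_derive1D (is_derive_expR _) (dN _))) (is_derive1B (is_derive_expR _) (dN _))) _).
  ring.
by rewrite mulr_ge0// subr_ge0 ler_expR; lra.
Qed.

(** [exp (- u ^+ 2 / 2) * cosh u] is nonincreasing for [u >= 0], since its derivative has the sign
    of [sinh u - u * cosh u]. *)
Lemma cosh_le (t : R) : 0 <= t -> (expR t + expR (- t)) / 2 <= expR (t ^+ 2 / 2).
Proof.
move=> t0.
have dN (u : R) : is_derive u 1 (fun u => expR (- u)) (- expR (- u)).
  refine (is_derive1_eq (is_derive1O (is_derive_expR _) (is_derive1N (is_derive1I _))) _).
  by rewrite mulrN1.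
have dE (u : R) : is_derive u 1 (fun u => expR (- (u ^+ 2 / 2))) (- u * expR (- (u ^+ 2 / 2))).
  refine (is_derive1_eq (is_derive1O (is_derive_expR _) (is_derive1N
    (is_derive1M (is_derive1X2 (is_derive1I _)) (is_derive1C _ _)))) _).
  by field.
have := @le_of_derive_ge0 R
  (fun u => - (expR (- (u ^+ 2 / 2)) * (expR u + expR (- u))))
  (fun u => expR (- (u ^+ 2 / 2)) * (u * (expR u + expR (- u)) - (expR u - expR (- u))))
  0 t t0.
rewrite expr0n mul0r !oppr0 expR0 mul1r lerN2 => H.
have {}H : expR (- (t ^+ 2 / 2)) * (expR t + expR (- t)) <= 1 + 1.
  apply: H => u /andP[u0 _].
    refine (is_derive1_eq (is_derive1N (is_derive1M (dE _)
      (is_derive1D (is_derive_expR _) (dN _)))) _).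
    ring.
  by rewrite mulr_ge0 ?expR_ge0// subr_ge0 sinh_le.
rewrite -(ler_pM2l (expR_gt0 (- (t ^+ 2 / 2)))) -expRD addNr expR0; lra.
Qed.

(** The coefficient [1 / 2] has to be exact, so that the terms of order [t ^+ 2] cancel in
    [heat_step]; the last term may be crude. *)
Lemma invsqrt_le (t : R) : 0 <= t <= 1 / 2 ->
  (Num.sqrt (1 - t ^+ 2))^-1 <= 1 + t ^+ 2 / 2 + t ^+ 4.
Proof.
move=> t01; have p : 0 < 1 - t ^+ 2 by nra.
have z0 : 0 <= t ^+ 2 by exact: sqr_ge0.
have z1 : t ^+ 2 <= 1 / 4 by nra.
have -> : t ^+ 4 = (t ^+ 2) ^+ 2 by rewrite -exprM.
move: p z0 z1; set z := t ^+ 2 => p z0 z1.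
have q : 0 < 1 + z / 2 + z ^+ 2 by nra.
have S0 : 0 < Num.sqrt (1 - z) by rewrite sqrtr_gt0.
have SE : Num.sqrt (1 - z) ^+ 2 = 1 - z by rewrite sqr_sqrtr// ltW.
rewrite -[X in X <= _]mul1r ler_pdivrMr//.
have z2 : z ^+ 2 <= 1 by nra.
have z3 : z ^+ 3 <= 1 / 4 by rewrite exprS; have := sqr_ge0 z; nra.
have zz : 0 <= z ^+ 2 * (5 / 4 * (1 - z) - z ^+ 3) by rewrite mulr_ge0 ?sqr_ge0//; lra.
have p1 : 0 <= (1 + z / 2 + z ^+ 2) * Num.sqrt (1 - z) by rewrite mulr_ge0// ltW.
have : 1 ^+ 2 <= ((1 + z / 2 + z ^+ 2) * Num.sqrt (1 - z)) ^+ 2.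
  by rewrite exprMn SE; lra.
by rewrite ler_sqr ?nnegrE.
Qed.

(* AM-GM, [|F D| <= c p / 2 + D ^+ 2 / (2 c p)], turns the bound into the
   chi-square distance of the two sides, a combination of normal densities. *)
Lemma heat_step F (x v h : R) : measurable_fun setT F -> (forall y, `|F y| <= 1) ->
  0 < v -> h != 0 -> 2 * h ^+ 2 <= v ->
  `|(gint F (x + h) v + gint F (x - h) v) / 2 - gint F x (v + h ^+ 2)|
    <= (h ^+ 2 / v) ^+ 2.
Proof.
move=> mF F1 v0 h0 hv; set t := h ^+ 2 / v.
have t0 : 0 < t by rewrite divr_gt0// exprn_even_gt0.
have t2 : t <= 1 / 2 by rewrite ler_pdivrMr//; lra.
have ew : v + h ^+ 2 = v * (1 + t) by rewrite /t; field; rewrite gt_eqF.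
rewrite ew; set w := v * (1 + t).
(* The chi-square mass will be at most [t ^+ 4], and [c / 2 + t ^+ 4 / (2 * c)] equals [t ^+ 2] at
   this [c]. *)
pose c := t ^+ 2; have c0 : 0 < c by rewrite exprn_gt0.
pose K := (Num.sqrt (1 - t ^+ 2))^-1.
pose l1 : seq (R * (R * R)) :=
  [:: (1 / 2, (x + h, v)); (1 / 2, (x - h, v)); (- 1, (x, w))].
(* The first entry is the AM-GM term; the other six expand the square of [comb l1], divided by
   [2 * c * pd x v]. *)
pose l2 : seq (R * (R * R)) := [:: (c / 2, (x, v));
  ((2 * c)^-1 * (expR t / 4), (x + 2 * h, v));
  ((2 * c)^-1 * (expR t / 4), (x + 2 * - h, v));
  ((2 * c)^-1 * (expR (- t) / 2), (x, v));
  (- (2 * c)^-1 * expR (t ^+ 2 / 2), (x + h * (1 + t), w));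
  (- (2 * c)^-1 * expR (t ^+ 2 / 2), (x + - h * (1 + t), w));
  ((2 * c)^-1 * K, (x, w / (1 - t)))].
have := @gint_comb_dist F l1 l2 [::] 1 mF F1.
have e1 : \sum_(p <- l1) p.1 * gint F p.2.1 p.2.2
   - \sum_(p <- [::] : seq (R * (R * R))) p.1
   = (gint F (x + h) v + gint F (x - h) v) / 2 - gint F x w.
  move: (gint F) => G; rewrite big_nil /l1 3!big_cons big_nil.
  by rewrite [LHS]/=; field.
rewrite e1 => H; apply: le_trans (H _) _ => {H e1} [y|].
  rewrite {2}/comb big_nil subr0.
  have D1 : comb l1 y = (pd (x + h) v y + pd (x - h) v y) / 2 - pd x w y.
    by rewrite /comb /l1; move: pd => p; rewrite 3!big_cons big_nil [LHS]/=; field.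
  have p0 := pd_gt0 x y v0.
  have D2 : comb l2 y = c / 2 * pd x v y
      + (2 * c)^-1 * (comb l1 y ^+ 2 / pd x v y).
    rewrite D1; have hN : x - h = x + - h by [].
    have tN : (- h) ^+ 2 / v = t by rewrite sqrrN.
    have := pd_shift_sqr x h y v0; have := pd_shift_sqr x (- h) y v0.
    have := pd_shift_cross x h y v0; have := pd_shift_wide x h y v0.
    have := pd_shift_wide x (- h) y v0.
    have := @pd_wide_sqr x v t y v0; rewrite /= tN -/t -/w -/K.
    move=> i6 i5 i4 i3 i2 i1.
    have {}i6 := i6 ltac:(lra).
    have -> : comb l2 y = c / 2 * pd x v y + (2 * c)^-1 * (
       (expR t * pd (x + 2 * h) v y) / 4 + (expR t * pd (x + 2 * - h) v y) / 4
       + (expR (- t) * pd x v y) / 2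
       - expR (t ^+ 2 / 2) * pd (x + h * (1 + t)) w y
       - expR (t ^+ 2 / 2) * pd (x + - h * (1 + t)) w y
       + K * pd x (w / (1 - t)) y).
      clear; rewrite /comb /l2; move: pd => p; rewrite 7!big_cons big_nil [LHS]/=.
      by move: (2 * c)^-1 => a; field.
    rewrite -i1 -i2 -i3 -i4 -i5 -i6; congr (_ + _ * _); field; lra.
  rewrite D2; set D := comb l1 y.
  have h1 : `|F y * D| <= `|D|.
    by rewrite normrM ler_piMl.
  apply: le_trans h1 _; rewrite -[D ^+ 2]real_normK ?num_real//.
  have cp : 0 < c * pd x v y by rewrite mulr_gt0.
  have -> : c / 2 * pd x v y + (2 * c)^-1 * (`|D| ^+ 2 / pd x v y) =
    ((c * pd x v y) ^+ 2 + `|D| ^+ 2) / (2 * (c * pd x v y)) by field; lra.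
  have cp2 : 0 < 2 * (c * pd x v y) by rewrite pmulr_rgt0.
  rewrite ler_pdivlMr//.
  have := sqr_ge0 (c * pd x v y - `|D|); lra.
rewrite /l2 7!big_cons big_nil addr0 [X in X <= _]/=.
have h1 := cosh_le (ltW t0).
have h2 : 1 + t ^+ 2 / 2 <= expR (t ^+ 2 / 2) by exact: expR_ge1Dx.
have h3 : K <= 1 + t ^+ 2 / 2 + t ^+ 4 by apply: invsqrt_le; lra.
have h4 : (expR t + expR (- t)) / 2 - 2 * expR (t ^+ 2 / 2) + K <= t ^+ 4 by lra.
have e : forall a b d e : R, c / 2 + (a * (b / 4) + (a * (b / 4) + (a * (d / 2) + (- a * e +
   (- a * e + a * K))))) = c / 2 + a * ((b + d) / 2 - 2 * e + K).
  by move=> *; field.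
rewrite e; have i0 : 0 < (2 * c)^-1 by rewrite invr_gt0 mulr_gt0.
have := ler_wpM2l (ltW i0) h4.
have -> : (2 * c)^-1 * t ^+ 4 = t ^+ 2 / 2 by rewrite /c; field; lra.
rewrite /c; lra.
Qed.

End gaussian_combinations.

Lemma bounded_integrable d (T : measurableType d) (R : realType)
    (P : probability T R) (F : T -> R) (M : R) :
  measurable_fun setT F -> (forall x, `|F x| <= M) ->
  P.-integrable setT (EFin \o F).
Proof.
move=> mF FM.
apply: (@le_integrable _ _ _ P _ measurableT _ (EFin \o cst M)).
- exact/measurable_EFinP.
- by move=> y _ /=; rewrite lee_fin (le_trans (FM y))// ler_norm.
- exact: finite_measure_integrable_cst.
Qed.

Section clt.
Context {R : realType}.
Implicit Types (F : R -> R) (K e h v x : R).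
Notation mu := (@lebesgue_measure R).

Let avg_dist (a b a' b' c d e : R) : `|a - a'| <= d -> `|b - b'| <= d ->
  `|(a' + b') / 2 - c| <= e -> `|(a + b) / 2 - c| <= d + e.
Proof. by rewrite !ler_norml; lra. Qed.

Let dist4 (a b c d e : R) : `|a - b| <= e / 3 -> `|b - c| <= e / 3 ->
  `|c - d| <= e / 3 -> `|a - d| <= e.
Proof. by rewrite !ler_norml; lra. Qed.

(** Each step trades an average over [x + h] and [x - h] for an increase [h ^+ 2] of the variance.
    Averaging does not enlarge errors, so the [k] errors of [heat_step] simply add, each controlled
    by the smallest variance [v0]. *)
Lemma heat_walk F v0 h k v x : measurable_fun setT F -> (forall y, `|F y| <= 1) ->
  0 < v0 -> v0 <= v -> h != 0 -> 2 * h ^+ 2 <= v0 ->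
  `|walk (nseq k h) (fun y => gint F y v) x - gint F x (v + k%:R * h ^+ 2)|
    <= k%:R * (h ^+ 2 / v0) ^+ 2.
Proof.
move=> mF F1 v00 v0v h0 hv; elim: k x => [|k IH] x.
  by rewrite /= !mul0r addr0 subrr normr0.
rewrite [walk _ _ _]/=; set W := walk _ _; set v' := v + k%:R * h ^+ 2.
have hh : 0 <= h ^+ 2 by exact: sqr_ge0.
have kh : 0 <= k%:R * h ^+ 2 by rewrite mulr_ge0.
have v'0 : v0 <= v' by rewrite /v'; lra.
have e1 : v + k.+1%:R * h ^+ 2 = v' + h ^+ 2 by rewrite /v' -(natr1 k); ring.
rewrite e1.
have s1 : `|(gint F (x + h) v' + gint F (x - h) v') / 2 - gint F x (v' + h ^+ 2)|
    <= (h ^+ 2 / v0) ^+ 2.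
  apply: le_trans (heat_step _ mF F1 _ h0 _) _; [lra|lra|].
  rewrite ler_sqr ?nnegrE ?divr_ge0//; [|lra|lra].
  by rewrite ler_wpM2l// lef_pV2 ?posrE//; lra.
have := IH (x + h); have := IH (x - h); rewrite -/W -/v'.
move=> i1 i2; rewrite -(natr1 k) [X in _ <= X]mulrDl mul1r.
exact: avg_dist i2 i1 s1.
Qed.

(** Half of the exponent absorbs the square, by [u <= exp u] at [u = (y - x) ^+ 2 / (4 * v)]; the
    other half is the exponent for variance [2 * v], and [sqrt 2] is the ratio of the
    normalisations. *)
Lemma pd_square_le x v y : 0 < v ->
  (y - x) ^+ 2 * pd x v y <= 4 * v * Num.sqrt 2 * pd x (2 * v) y.
Proof.
move=> v0; have v20 : 0 < 2 * v by rewrite mulr_gt0.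
have P0 : 0 < pi *+ 2 :> R by rewrite mulrn_wgt0// pi_gt0.
rewrite !pdE//.
have -> : Num.sqrt (2 * v * (pi *+ 2)) = Num.sqrt 2 * Num.sqrt (v * (pi *+ 2)) :> R.
  by rewrite -sqrtrM// mulrA.
set A := Num.sqrt (v * _); have A0 : 0 < A by rewrite sqrtr_gt0 mulr_gt0.
have s2 : 0 < Num.sqrt 2 :> R by rewrite sqrtr_gt0.
set q := (y - x) ^+ 2.
have -> : 4 * v * Num.sqrt 2 * ((Num.sqrt 2 * A)^-1 * expR (- (q / (2 * (2 * v)))))
   = A^-1 * (4 * v * expR (- (q / (4 * v)))).
  have -> : 2 * (2 * v) = 4 * v by ring.
  by move: (expR _) => E; field; lra.
rewrite mulrCA ler_pM2l ?invr_gt0//.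
have -> : - (q / (2 * v)) = - (q / (4 * v)) - q / (4 * v) by field; lra.
have -> : q * expR (- (q / (4 * v)) - q / (4 * v)) =
  expR (- (q / (4 * v))) * (q * expR (- (q / (4 * v)))) by rewrite expRD; ring.
rewrite mulrC ler_pM2r ?expR_gt0//.
have -> : q * expR (- (q / (4 * v))) = (4 * v) * ((q / (4 * v)) / expR (q / (4 * v))).
  by rewrite expRN; have := expR_gt0 (q / (4 * v)) => h; field; lra.
rewrite ler_piMr//; first by lra.
by rewrite ler_pdivrMr ?expR_gt0// mul1r; have := expR_ge1Dx (q / (4 * v)); lra.
Qed.

(** With [s = sqrt v], [|y - x| <= s / 2 + (y - x) ^+ 2 / (2 * s)] and [pd_square_le] give the
    constant [1 / 2 + 2 * sqrt 2], which is below [4]. *)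
Lemma gint_near F K x v : measurable_fun setT F -> (forall y, `|F y| <= 1) ->
  0 <= K -> (forall y z, `|F y - F z| <= K * `|y - z|) -> 0 < v ->
  `|gint F x v - F x| <= 4 * K * Num.sqrt v.
Proof.
move=> mF F1 K0 lipF v0; set s := Num.sqrt v.
have s0 : 0 < s by rewrite sqrtr_gt0.
have ss : s ^+ 2 = v by rewrite sqr_sqrtr// ltW.
pose l1 : seq (R * (R * R)) := [:: (1, (x, v))].
pose l3 : seq (R * (R * R)) := [:: (F x, (x, v))].
pose l2 : seq (R * (R * R)) := [:: (K * s / 2, (x, v));
   (K * (2 * s) * Num.sqrt 2, (x, 2 * v))].
have := @gint_comb_dist R F l1 l2 l3 1 mF F1.
have -> : \sum_(p <- l1) p.1 * gint F p.2.1 p.2.2 - \sum_(p <- l3) p.1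
   = gint F x v - F x.
  by move: (gint F) => G; rewrite /l1 /l3 !big_cons !big_nil [LHS]/=; ring.
move=> H; apply: le_trans (H _) _ => {H} [y|].
  have -> : F y * comb l1 y - comb l3 y = (F y - F x) * pd x v y.
    by rewrite /comb /l1 /l3 !big_cons !big_nil [LHS]/=; ring.
  have -> : comb l2 y = K * (s / 2 * pd x v y
      + (2 * s)^-1 * (4 * v * Num.sqrt 2 * pd x (2 * v) y)).
    rewrite /comb /l2 !big_cons !big_nil [LHS]/= -ss.
    by move: (pd _ _ _) (pd _ _ _) => a b; field; lra.
  rewrite normrM (ger0_norm (pd_ge0 _ _ _)).
  apply: (le_trans (_ : _ <= K * `|y - x| * pd x v y)).
    by rewrite ler_wpM2r ?pd_ge0.
  rewrite -mulrA ler_wpM2l//.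
  apply: (le_trans (_ : _ <=
      s / 2 * pd x v y + (2 * s)^-1 * ((y - x) ^+ 2 * pd x v y))); last first.
    by rewrite lerD2l ler_pM2l ?invr_gt0 ?mulr_gt0// pd_square_le.
  rewrite mulrA -mulrDl ler_wpM2r ?pd_ge0//.
  have -> : s / 2 + (2 * s)^-1 * (y - x) ^+ 2 = (s ^+ 2 + `|y - x| ^+ 2) / (2 * s).
    by rewrite real_normK ?num_real//; field; lra.
  rewrite ler_pdivlMr ?mulr_gt0//.
  by have := sqr_ge0 (s - `|y - x|); lra.
rewrite /l2 !big_cons big_nil addr0 [X in X <= _]/=.
have s2 : Num.sqrt 2 <= 3 / 2 :> R by apply: sqrt_le; rewrite ?expr2; lra.
have Ks : 0 <= K * s by rewrite mulr_ge0// ltW.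
have := ler_wpM2l Ks s2; lra.
Qed.

(** The chi-square argument for a change of variance: the squared density difference over [pd 0 1]
    has mass [K - 1], of order [v ^+ 2 / 2], and the AM-GM weight is [v]. *)
Lemma gint_var F v : measurable_fun setT F -> (forall y, `|F y| <= 1) ->
  0 < v <= 1 / 2 -> `|gint F 0 (1 + v) - gint F 0 1| <= v.
Proof.
move=> mF F1 v01; have v0 : 0 < v by lra.
pose K := (Num.sqrt (1 - v ^+ 2))^-1.
pose l1 : seq (R * (R * R)) := [:: (1, (0, 1 + v)); (-1, (0, 1))].
pose l2 : seq (R * (R * R)) := [:: (v / 2 + (2 * v)^-1, (0, 1));
   (- v^-1, (0, 1 + v)); ((2 * v)^-1 * K, (0, (1 + v) / (1 - v)))].
have := @gint_comb_dist R F l1 l2 [::] 1 mF F1.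
have -> : \sum_(p <- l1) p.1 * gint F p.2.1 p.2.2
   - \sum_(p <- ([::] : seq (R * (R * R)))) p.1
   = gint F 0 (1 + v) - gint F 0 1.
  by move: (gint F) => G; rewrite big_nil /l1 2!big_cons big_nil [LHS]/=; ring.
move=> H; apply: le_trans (H _) _ => {H} [y|].
  have p0 := @pd_gt0 R 0 1 y ltr01.
  have D1 : comb l1 y = pd 0 (1 + v) y - pd 0 1 y.
    by rewrite /comb /l1 !big_cons !big_nil [LHS]/=; ring.
  rewrite {2}/comb big_nil subr0.
  have := @pd_wide_sqr R 0 1 v y ltr01; rewrite !mul1r => /(_ _)/=.
  move=> /(_ ltac:(lra)) i6.
  have -> : comb l2 y = v / 2 * pd 0 1 y + (2 * v)^-1 * (comb l1 y ^+ 2 / pd 0 1 y).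
    have -> : comb l2 y = (v / 2 + (2 * v)^-1) * pd 0 1 y - v^-1 * pd 0 (1 + v) y
        + (2 * v)^-1 * (K * pd 0 ((1 + v) / (1 - v)) y).
      by rewrite /comb /l2 !big_cons !big_nil [LHS]/=; ring.
    rewrite -i6 D1; field; lra.
  set D := comb l1 y.
  have h1 : `|F y * D| <= `|D| by rewrite normrM ler_piMl.
  apply: le_trans h1 _; rewrite -[D ^+ 2]real_normK ?num_real//.
  have cp : 0 < v * pd 0 1 y by rewrite mulr_gt0.
  have -> : v / 2 * pd 0 1 y + (2 * v)^-1 * (`|D| ^+ 2 / pd 0 1 y) =
    ((v * pd 0 1 y) ^+ 2 + `|D| ^+ 2) / (2 * (v * pd 0 1 y)) by field; lra.
  have cp2 : 0 < 2 * (v * pd 0 1 y) by rewrite pmulr_rgt0.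
  rewrite ler_pdivlMr//.
  by have := sqr_ge0 (v * pd 0 1 y - `|D|); lra.
rewrite /l2 !big_cons big_nil addr0 [X in X <= _]/=.
have h3 : K <= 1 + v ^+ 2 / 2 + v ^+ 4 by apply: invsqrt_le; lra.
have -> : v / 2 + (2 * v)^-1 + (- v^-1 + (2 * v)^-1 * K) = v / 2 + (K - 1) / (2 * v).
  by field; lra.
have : (K - 1) / (2 * v) <= v / 2.
  rewrite ler_pdivrMr ?mulr_gt0//.
  have v4 : v ^+ 4 <= v ^+ 2 / 4.
    have -> : v ^+ 4 = v ^+ 2 * v ^+ 2 by rewrite -exprD.
    have : v ^+ 2 <= 1 / 4 by nra.
    by have := sqr_ge0 v; nra.
  by have := sqr_ge0 v; lra.
lra.
Qed.

(** The Radon-Nikodym derivative agrees almost everywhere with [normal_pdf], since both integrate to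
    the same measure. *)
Lemma integral_normal_prob m v (f : R -> \bar R) :
  (normal_prob m v).-integrable setT f ->
  (\int[normal_prob m v]_x f x = \int[mu]_x (f x * (normal_pdf m v x)%:E))%E.
Proof.
move=> fi; have mf := measurable_int _ fi.
rewrite -(Radon_Nikodym_change_of_variables (normal_prob_dominates m v))//=.
apply: ae_eq_integral => //.
- apply: emeasurable_funM => //; apply: (measurable_int mu).
  by apply: Radon_Nikodym_integrable; exact: normal_prob_dominates.
- apply: emeasurable_funM => //=; apply/measurableT_comp => //=.
  exact: measurable_normal_pdf.
- apply: ae_eqe_mul2l => /=.
  rewrite Radon_NikodymE//=; first exact: normal_prob_dominates.
  move=> nmu; case: cid => /= h [h1 h2 h3].
  apply: integral_ae_eq => //=.
  + by apply/measurableT_comp =>//; exact: measurable_normal_pdf.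
  + by move=> E E01 mE; rewrite -h3.
Qed.

Lemma integral_gamma (F : R -> R) : measurable_fun setT F ->
  (forall y, `|F y| <= 1) -> \int[gamma]_y F y = gint F 0 1.
Proof.
move=> mF F1; rewrite /Rintegral integral_normal_prob.
  by rewrite /gint /Rintegral /pd sqrtr1.
exact: (@bounded_integrable _ _ _ gamma F 1).
Qed.

Lemma lipschitz_measurable F K : (forall y z, `|F y - F z| <= K * `|y - z|) ->
  measurable_fun setT F.
Proof.
move=> lipF; apply: continuous_measurable_fun => x.
apply/cvgrPdist_lt => e e0.
have K1 : 0 < `|K| + 1 by rewrite ltr_wpDl.
near=> y; apply: le_lt_trans (lipF _ _) _.
apply: (@le_lt_trans _ _ ((`|K| + 1) * `|x - y|)).
  by rewrite ler_wpM2r//; have := ler_norm K; lra.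
rewrite -ltr_pdivlMl// mulrC; near: y.
apply: cvgr_dist_lt => //; first by rewrite divr_gt0.
Unshelve. all: by end_near. Qed.

(* The Lindeberg scheme for the smoothing [y |-> gint F y v] of [F]. *)
Lemma clt K e : 0 <= K -> 0 < e -> exists n0, forall n, (n0 <= n)%N ->
  forall F, (forall y z, `|F y - F z| <= K * `|y - z|) -> (forall y, `|F y| <= 1) ->
  `|walk (nseq n.+1 (Num.sqrt n.+1%:R)^-1) F 0 - \int[gamma]_y F y| <= e.
Proof.
move=> K0 e0.
have [v [v0 v1 vK ve]] : exists v, [/\ 0 < v, v <= 1 / 2, 4 * K * Num.sqrt v <= e / 3
    & v <= e / 3].
  (* [v] is taken as [u ^+ 2], so that [sqrt v = u]; since [u <= 1 / 2], the bounds on [u] also hold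
     for [v]. *)
  pose u := Num.min (1 / 2) (Num.min (e / 3) (e / 3 / (4 * K + 1))).
  have K1 : 0 < 4 * K + 1 by lra.
  have u0 : 0 < u by rewrite !lt_min; apply/and3P; split; rewrite ?divr_gt0//; lra.
  have [h1 h2 h3] : [/\ u <= 1 / 2, u <= e / 3 & u <= e / 3 / (4 * K + 1)].
    by rewrite /u !ge_min !lexx ?orbT.
  exists (u ^+ 2); rewrite exprn_gt0//; split => //; [nra| |nra].
  rewrite sqrtr_sqr gtr0_norm//.
  by move: h3; rewrite ler_pdivlMr//; nra.
(* With [h ^+ 2 = 1 / N], the first bound gives [2 * h ^+ 2 <= v] and the second makes the
   accumulated error [N * (N^-1 / v) ^+ 2] at most [e / 3]. *)
pose n0 := Num.truncn (Num.max (2 / v) (3 / (e * v ^+ 2))).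
exists n0 => n nn0 F lipF F1; set N : R := n.+1%:R; set h := (Num.sqrt N)^-1.
have mF := lipschitz_measurable lipF.
have N0 : 0 < N by rewrite ltr0n.
have Nbig : Num.max (2 / v) (3 / (e * v ^+ 2)) <= N.
  by apply: le_trans (ltW (truncnS_gt _)) _; rewrite ler_nat ltnS.
have h2 : h ^+ 2 = N^-1 by rewrite exprVn sqr_sqrtr// ltW.
have h0 : h != 0 by rewrite invr_neq0// gt_eqF// sqrtr_gt0.
have [N1 N2] : 2 <= v * N /\ 3 <= e * v ^+ 2 * N.
  move: Nbig; rewrite ge_max => /andP[].
  rewrite ler_pdivrMr// ler_pdivrMr ?mulr_gt0 ?exprn_gt0//.
  by split; lra.
have a1 : `|walk (nseq n.+1 h) F 0 - walk (nseq n.+1 h) (fun y => gint F y v) 0| <= e / 3.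
  apply: walk_dist => y; rewrite distrC; apply: le_trans vK.
  exact: gint_near.
have hv : 2 * h ^+ 2 <= v by rewrite h2 ler_pdivrMr.
have := heat_walk n.+1 0 mF F1 v0 (lexx v) h0 hv.
rewrite h2 -/N divff ?gt_eqF// => a2.
have a3 : N * (N^-1 / v) ^+ 2 <= e / 3.
  have -> : N * (N^-1 / v) ^+ 2 = (N * v ^+ 2)^-1 by field; lra.
  rewrite -[leLHS]mul1r ler_pdivrMr ?mulr_gt0 ?exprn_gt0//; lra.
have a4 : `|gint F 0 (v + 1) - gint F 0 1| <= e / 3.
  by rewrite [v + 1]addrC; apply: le_trans ve; apply: gint_var => //; lra.
rewrite integral_gamma//.
exact: dist4 a1 (le_trans a2 a3) a4.
Qed.

End clt.

(** * The central limit theorem in dimension [d] *)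

Section clt_rV.
Context {R : realType}.

Local Notation e_ i := (delta_mx ord0 i).

Lemma rV_consE d (t : R) (v : 'rV[R]_d) (i : 'I_d.+1) :
  rV_cons (t, v) ord0 i = if unlift ord0 i is Some j then v ord0 j else t.
Proof.
case: unliftP => [j ->|->].
  have -> : lift ord0 j = rshift 1 j by apply: val_inj.
  exact: row_mxEr.
have -> : ord0 = lshift d (ord0 : 'I_1) by apply: val_inj.
by apply: (etrans (row_mxEl _ _ _ _)); rewrite mxE eqxx mulr1n.
Qed.

Lemma rV_cons_fst d (t s : R) (v : 'rV[R]_d) :
  rV_cons (t, v) = rV_cons (s, v) + (t - s) *: e_ ord0.
Proof.
apply/rowP => i; rewrite [RHS]mxE !rV_consE !mxE; case: unliftP => [j ->|->].
  have /negbTE -> : lift ord0 j != ord0 by rewrite eq_sym neq_lift.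
  by rewrite andbF mulr0 addr0.
by rewrite !eqxx mulr1 addrC subrK.
Qed.

Lemma rV_cons_snd d (t s : R) (v : 'rV[R]_d) (i : 'I_d) :
  rV_cons (t, v + s *: e_ i) = rV_cons (t, v) + s *: e_ (lift ord0 i).
Proof.
apply/rowP => j; rewrite [RHS]mxE !rV_consE !mxE; case: unliftP => [k ->|->].
  by rewrite !mxE (inj_eq (@lift_inj _ ord0)).
by rewrite (negbTE (neq_lift _ _)) andbF mulr0 addr0.
Qed.

Lemma rV_cons0 d : rV_cons (0 : R, 0 : 'rV[R]_d) = 0.
Proof.
by apply/rowP => j; rewrite rV_consE [RHS]mxE; case: unliftP => [k _|_] //; rewrite mxE.
Qed.

Lemma rV_consD d (t s : R) (v w : 'rV[R]_d) :
  rV_cons (t + s, v + w) = rV_cons (t, v) + rV_cons (s, w).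
Proof.
apply/rowP => j; rewrite [RHS]mxE !rV_consE; case: unliftP => [k _|_] //.
by rewrite mxE.
Qed.

Lemma rV_consN d (t : R) (v : 'rV[R]_d) : rV_cons (- t, - v) = - rV_cons (t, v).
Proof.
apply/rowP => j; rewrite [RHS]mxE !rV_consE; case: unliftP => [k _|_] //.
by rewrite mxE.
Qed.

(** For each axis, [n] copies of the step [t] along it, built through [rV_cons] in parallel with the
    recursion of [gaussian]. *)
Fixpoint axes (n : nat) (t : R) (d : nat) : seq 'rV[R]_d :=
  if d is d'.+1 then
    [seq rV_cons (s, 0) | s <- nseq n t] ++
    [seq rV_cons (0, v) | v <- axes n t d']
  else [::].

Lemma rV_cons_e0 d (t : R) : rV_cons (t, 0 : 'rV[R]_d) = t *: e_ ord0.
Proof. by rewrite (rV_cons_fst _ 0) rV_cons0 subr0 add0r. Qed.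

Lemma rV_cons_e d (t : R) (i : 'I_d) : rV_cons (0, t *: e_ i) = t *: e_ (lift ord0 i).
Proof. by rewrite -[t *: e_ i]add0r rV_cons_snd rV_cons0 add0r. Qed.

Lemma axesP n t d h : h \in axes n t d -> exists i, h = t *: e_ i.
Proof.
elim: d h => [//|d IH] h; rewrite mem_cat => /orP[|] /mapP[s].
  by rewrite mem_nseq => /andP[_ /eqP ->] ->; exists ord0; exact: rV_cons_e0.
by move=> /IH[i ->] ->; exists (lift ord0 i); exact: rV_cons_e.
Qed.

Lemma axes_sum n t d (D : 'rV[R]_d -> R) :
  \sum_(h <- axes n t d) D h = n%:R * \sum_i D (t *: e_ i).
Proof.
elim: d D => [|d IH] D; first by rewrite big_nil big_ord0 mulr0.
rewrite big_cat big_ord_recl mulrDr/= !big_map IH; congr (_ + _ * _).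
  by rewrite big_nseq -rV_cons_e0 iter_addr_0 mulr_natl.
by apply: eq_bigr => i _; rewrite rV_cons_e.
Qed.

Definition coord_lip d (K : R) (F : 'rV[R]_d -> R) :=
  forall x i t, `|F (x + t *: e_ i) - F x| <= K * `|t|.

Lemma coord_lip_continuous d (K : R) (F : 'rV[R]_d -> R) : 0 <= K -> coord_lip K F ->
  continuous F.
Proof.
move=> K0 lipF x.
have key (y : 'rV[R]_d) (e : R) : 0 < e -> (forall i, `|y ord0 i - x ord0 i| <= e) ->
    `|F y - F x| <= K * e * d%:R.
  move=> e0 yx.
  (* Hybrid vectors: the coordinates of [x] are replaced by those of [y] one at a time, each at a
     cost of at most [K * e]. *)
  pose z k := \row_(i < d) (if (i < k)%N then y ord0 i else x ord0 i).
  have zk k : (k <= d)%N -> `|F (z k) - F x| <= K * e * k%:R.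
    elim: k => [_|k IH kd].
      rewrite (_ : z 0%N = x) ?subrr ?normr0 ?mulr0//.
      by apply/rowP => i; rewrite mxE.
    have E : z k.+1 = z k + (y ord0 (Ordinal kd) - x ord0 (Ordinal kd)) *: e_ (Ordinal kd).
      apply/rowP => i; rewrite !mxE/= ltnS leq_eqVlt -val_eqE/=.
      have [ik|ik] := eqVneq (i : nat) k.
        rewrite ik ltnn/= mulr1 addrC; have -> : i = Ordinal kd by exact: val_inj.
        by rewrite subrK.
      by rewrite mulr0 addr0.
    have h1 := lipF (z k) (Ordinal kd) (y ord0 (Ordinal kd) - x ord0 (Ordinal kd)).
    have h2 := IH (ltnW kd).
    have h3 := ler_wpM2l K0 (yx (Ordinal kd)).
    rewrite -E in h1; rewrite -(natr1 k) mulrDr mulr1.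
    apply: le_trans (ler_distD (F (z k)) _ _) _.
    by rewrite addrC lerD// (le_trans h1).
  have -> : y = z d by apply/rowP => i; rewrite mxE ltn_ord.
  exact: zk.
apply/(@cvgrPdist_lt _ _ _ _ (@nbhs_filter 'rV[R]_d x)) => e e0.
pose r := e / (K + 1) / (d%:R + 1).
have K1 : 0 < K + 1 by rewrite ltr_wpDl.
have d1 : 0 < d%:R + 1 :> R by rewrite ltr_wpDl.
have r0 : 0 < r by rewrite !divr_gt0.
apply/nbhs_ballP; exists r => // y [_ bxy].
rewrite distrC; apply: (le_lt_trans (key y r r0 _)).
  by move=> i; have := bxy ord0 i; rewrite /ball/= distrC => /ltW.
have -> : e = (K + 1) * r * (d%:R + 1) by rewrite /r; field; rewrite !gt_eqF.
have d0 : 0 <= d%:R :> R by [].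
have h1 : K * r < (K + 1) * r by rewrite ltr_pM2r// ltrDl.
have h2 : 0 <= K * r by rewrite mulr_ge0// ltW.
nra.
Qed.

Lemma continuous_measurable_rV d (F : 'rV[R]_d -> R) : continuous F ->
  measurable_fun setT F.
Proof.
move=> cF; apply: (measurability _ (RGenOpens.measurableE R)) => _ [_ [a [b ->] <-]].
rewrite setTI; apply: open_measurable_rV.
by apply: open_comp (interval_open _ _) => // v _; exact: cF.
Qed.

Definition gauss_mean d (F : 'rV[R]_d -> R) : R := \int[gaussian d]_x F x.

Lemma prob_integral01 d' (T : measurableType d') (P : probability T R) (F : T -> R) :
  measurable_fun setT F -> (forall x, 0 <= F x <= 1) ->
  (\int[P]_x (F x)%:E = (\int[P]_x F x)%:E)%E /\ 0 <= \int[P]_x F x <= 1.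
Proof.
move=> mF F01.
have iF : P.-integrable setT (EFin \o F).
  apply: (@bounded_integrable _ _ _ _ _ 1) => // x.
  by have /andP[? ?] := F01 x; rewrite ger0_norm.
split; first by rewrite /Rintegral fineK//; exact: integrable_fin_num.
rewrite Rintegral_ge0/=; last by move=> x _; case/andP: (F01 x).
have -> : 1 = \int[P]_x (cst 1 x) :> R.
  by rewrite Rintegral_cst//= probability_setT mul1r.
apply: le_Rintegral => //.
  exact: finite_measure_integrable_cst.
by move=> x _; case/andP: (F01 x).
Qed.

Lemma gauss_meanS d (F : 'rV[R]_d.+1 -> R) : measurable_fun setT F ->
  (forall x, 0 <= F x <= 1) ->
  gauss_mean F = \int[gamma]_t gauss_mean (fun v => F (rV_cons (t, v))).
Proof.
move=> mF F01; rewrite /gauss_mean {1}/Rintegral /=.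
rewrite ge0_integral_distribution; last 2 first.
- by apply: measurableT_comp.
- by move=> y; rewrite lee_fin; case/andP: (F01 y).
rewrite fubini_tonelli1; last 2 first.
- apply: (measurableT_comp (f := EFin \o F)); first exact: measurableT_comp.
  exact: measurable_rV_cons.
- by move=> y; rewrite /= lee_fin; case/andP: (F01 (rV_cons y)).
rewrite /Rintegral; congr fine; apply: eq_integral => t _.
rewrite /fubini_F/=.
have mFt : measurable_fun setT (fun v : 'rV[R]_d => F (rV_cons (t, v))).
  apply: measurableT_comp => //; apply: measurableT_comp; first exact: measurable_rV_cons.
  exact: measurable_pair1.
by have [-> _] := prob_integral01 (gaussian d) mFt (fun v => F01 _).
Qed.

(** Induction on [d]: for each first coordinate [s] the walk along the other axes is replaced by the
    Gaussian mean [M s], then the one-dimensional theorem applies to [M], which inherits the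
    constant [K]. A threshold uniform in [F] serves all slices together. *)
Lemma clt_rV d (K e : R) : 0 <= K -> 0 < e -> exists n0, forall n, (n0 <= n)%N ->
  forall F : 'rV[R]_d -> R, coord_lip K F -> (forall x, 0 <= F x <= 1) ->
  `|walk (axes n.+1 (Num.sqrt n.+1%:R)^-1 d) F 0 - gauss_mean F| <= e.
Proof.
move=> K0; elim: d e => [|d IH] e e0.
  exists 0%N => n _ F lipF F01.
  have mF := continuous_measurable_rV (coord_lip_continuous K0 lipF).
  rewrite /gauss_mean/= /Rintegral integral_dirac//; last exact/measurable_EFinP.
  by rewrite diracT mul1e/= subrr normr0 ltW.
have e2 : 0 < e / 2 by rewrite divr_gt0.
have [n1 H1] := IH _ e2; have [n2 H2] := clt K0 e2.
exists (maxn n1 n2) => n; rewrite geq_max => /andP[n1n n2n] F lipF F01.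
have {H1} := H1 n n1n; have {H2} := H2 n n2n; set t := (Num.sqrt _)^-1 => H2 H1.
have lips s : coord_lip K (fun v : 'rV[R]_d => F (rV_cons (s, v))).
  by move=> x i u; rewrite rV_cons_snd; exact: lipF.
have mF := continuous_measurable_rV (coord_lip_continuous K0 lipF).
have ms s := continuous_measurable_rV (coord_lip_continuous K0 (lips s)).
pose M s := gauss_mean (fun v => F (rV_cons (s, v))).
have M01 s : 0 <= M s <= 1.
  by have [_] := prob_integral01 (gaussian d) (ms s) (fun v => F01 _).
have iFs s : (gaussian d).-integrable setT (EFin \o (fun v => F (rV_cons (s, v)))).
  apply: (@bounded_integrable _ _ _ _ _ 1) => // x.
  by have /andP[? ?] := F01 (rV_cons (s, x)); rewrite ger0_norm.
have lipM s u : `|M s - M u| <= K * `|s - u|.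
  have H a b : M a - M b <= K * `|a - b|.
    rewrite lerBlDl /M /gauss_mean.
    have -> : K * `|a - b| = \int[gaussian d]_x cst (K * `|a - b|) x.
      by rewrite Rintegral_cst//= probability_setT mulr1.
    rewrite -RintegralD//; last exact: finite_measure_integrable_cst.
    apply: le_Rintegral => //.
      rewrite (_ : _ \o _ = ((EFin \o (fun v => F (rV_cons (b, v))))
        \+ (EFin \o cst (K * `|a - b|)%R))%E).
        by apply: integrableD => //; exact: finite_measure_integrable_cst.
      by apply/funext.
    move=> v _ /=; rewrite -lerBlDl (rV_cons_fst a b).
    by apply: le_trans (ler_norm _) _; exact: lipF.
  by rewrite ler_norml lerNl opprB H distrC H.
rewrite gauss_meanS//.
have -> : axes n.+1 t d.+1 = [seq rV_cons (s, 0) | s <- nseq n.+1 t] ++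
  [seq rV_cons (0, v) | v <- axes n.+1 t d] by [].
rewrite walk_cat -rV_cons0; set G := walk _ F.
have -> : walk [seq rV_cons (s, 0) | s <- nseq n.+1 t] G (rV_cons (0, 0)) =
    walk (nseq n.+1 t) (fun s => G (rV_cons (s, 0))) 0.
  apply: (@walk_map _ _ _ (fun s => rV_cons (s, 0)) (fun s => rV_cons (s, 0))).
  - by move=> y h; rewrite -rV_consD addr0.
  - by move=> y h; rewrite -rV_consN -rV_consD oppr0 addr0.
have E s : G (rV_cons (s, 0)) = walk (axes n.+1 t d) (fun v => F (rV_cons (s, v))) 0.
  apply: (@walk_map _ _ _ (fun v => rV_cons (s, v)) (fun v => rV_cons (0, v))).
  - by move=> y h; rewrite -rV_consD addr0.
  - by move=> y h; rewrite -rV_consN -rV_consD oppr0 addr0.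
rewrite (eq_walk _ _ E).
apply: le_trans (ler_distD (walk (nseq n.+1 t) M 0) _ _) _.
rewrite [leRHS]splitr lerD//.
  by apply: walk_dist => s; exact: H1.
by apply: H2 => // s; have /andP[? ?] := M01 s; rewrite ger0_norm.
Qed.

End clt_rV.

(** * Passage to the Gaussian measure *)

Section gaussian_bobkov.
Context {R : realType}.

Local Notation e_ i := (delta_mx ord0 i).

Definition clamp01 (r : R) : R := Num.min 1 (Num.max 0 r).

Lemma clamp01_itv r : 0 <= clamp01 r <= 1.
Proof. by rewrite /clamp01 le_min ler01 le_max lexx ge_min lexx. Qed.

Lemma clamp01_ge1 r : 1 <= r -> clamp01 r = 1.
Proof. by move=> r1; rewrite /clamp01 min_l// le_max r1 orbT. Qed.

Lemma clamp01_le0 r : r <= 0 -> clamp01 r = 0.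
Proof. by move=> r0; rewrite /clamp01 [Num.max _ _]max_l// min_r. Qed.

Lemma clamp01_lip r s : `|clamp01 r - clamp01 s| <= `|r - s|.
Proof.
have rs := ler_norm (r - s); have := ler_norm (s - r).
rewrite distrC /clamp01 ler_norml /Num.max /Num.min => sr.
move: rs sr; set D := `|_| => rs sr.
by case: ifP; case: ifP; case: ifP; case: ifP; lra.
Qed.

Definition cutoff (rho eps r : R) : R := clamp01 ((rho + eps - r) / eps).

(** A Lipschitz majorant of the indicator of [[rho - k, rho + eps + k]], outside which [cutoff] does
    not change within distance [k]; being Lipschitz, it is accessible to [clt_rV]. *)
Definition bump (rho eps k r : R) : R :=
  clamp01 (Num.min ((r - (rho - 2 * k)) / k) ((rho + eps + 2 * k - r) / k)).

Lemma bump_itv rho eps k r : 0 <= bump rho eps k r <= 1.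
Proof. exact: clamp01_itv. Qed.

Lemma cutoff_lip rho eps r s : 0 < eps ->
  `|cutoff rho eps r - cutoff rho eps s| <= eps^-1 * `|r - s|.
Proof.
move=> e0; apply: le_trans (clamp01_lip _ _) _; rewrite -mulrBl.
have -> : rho + eps - r - (rho + eps - s) = s - r by ring.
by rewrite normrM distrC gtr0_norm ?invr_gt0// mulrC.
Qed.

Lemma cutoff1 rho eps r : 0 < eps -> r <= rho -> cutoff rho eps r = 1.
Proof. by move=> e0 rr; apply: clamp01_ge1; rewrite ler_pdivlMr//; lra. Qed.

Lemma cutoff0 rho eps r : 0 < eps -> rho + eps <= r -> cutoff rho eps r = 0.
Proof. by move=> e0 rr; apply: clamp01_le0; rewrite ler_pdivrMr//; lra. Qed.

Lemma bump_lip rho eps k r s : 0 < k ->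
  `|bump rho eps k r - bump rho eps k s| <= k^-1 * `|r - s|.
Proof.
move=> k0; apply: le_trans (clamp01_lip _ _) _.
have -> : (r - (rho - 2 * k)) / k = (s - (rho - 2 * k)) / k + (r - s) / k by field; lra.
have -> : (rho + eps + 2 * k - r) / k = (rho + eps + 2 * k - s) / k - (r - s) / k.
  by field; lra.
have -> : k^-1 * `|r - s| = `|(r - s) / k|.
  by rewrite normrM [in RHS]mulrC gtr0_norm// invr_gt0.
set u := (r - s) / k; set a := _ / k; set b := _ / k.
have := ler_norm u; have := ler_norm (- u); rewrite normrN ler_norml /Num.min.
set D := `|u| => h1 h2.
by case: ifP; case: ifP; lra.
Qed.

Lemma bump1 rho eps k r : 0 < k -> rho - k <= r -> r <= rho + eps + k ->
  bump rho eps k r = 1.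
Proof.
move=> k0 r1 r2; apply: clamp01_ge1.
by rewrite le_min; apply/andP; split; rewrite ler_pdivlMr//; lra.
Qed.

Lemma bump0l rho eps k r : 0 < k -> r <= rho - 2 * k -> bump rho eps k r = 0.
Proof.
move=> k0 r1; apply: clamp01_le0; rewrite ge_min; apply/orP; left.
by rewrite ler_pdivrMr//; lra.
Qed.

Lemma bump0r rho eps k r : 0 < k -> rho + eps + 2 * k <= r -> bump rho eps k r = 0.
Proof.
move=> k0 r1; apply: clamp01_le0; rewrite ge_min; apply/orP; right.
by rewrite ler_pdivrMr//; lra.
Qed.

Lemma cutoff_bump rho eps k r s W : 0 < eps -> 0 < k ->
  `|s - r| <= k -> `|s - r| <= W ->
  `|cutoff rho eps r - cutoff rho eps s| <= eps^-1 * W * bump rho eps k r.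
Proof.
move=> e0 k0 srk srW; have W0 : 0 <= W by apply: le_trans srW.
have B0 : 0 <= bump rho eps k r by have /andP[] := bump_itv rho eps k r.
have RHS0 : 0 <= eps^-1 * W * bump rho eps k r.
  by rewrite !mulr_ge0// invr_ge0 ltW.
move: (srk); rewrite ler_norml => /andP[h1 h2].
have [r1|r1] := leP (rho - k) r; last by rewrite !cutoff1 ?subrr ?normr0//; lra.
have [r2|r2] := leP r (rho + eps + k); last by rewrite !cutoff0 ?subrr ?normr0//; lra.
rewrite bump1// mulr1; apply: le_trans (cutoff_lip _ _ _ e0) _.
by rewrite distrC ler_wpM2l// invr_ge0 ltW.
Qed.

Lemma Iso_le1 (p : R) : Iso p <= 1.
Proof. by rewrite /Iso; case: ifP => // _; exact: phi_le1. Qed.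

(** [Iso] vanishes at [0] and [1], so only the band contributes; bounding it there by [1] produces
    the summand [1] of [1 + eps^-1]. *)
Lemma Iso_cutoff_bump rho eps k r : 0 < eps -> 0 < k ->
  Iso (cutoff rho eps r) <= bump rho eps k r.
Proof.
move=> e0 k0; have B0 : 0 <= bump rho eps k r by have /andP[] := bump_itv rho eps k r.
have [r1|r1] := leP (rho - k) r; last by rewrite cutoff1 ?Iso1//; lra.
have [r2|r2] := leP r (rho + eps + k); last by rewrite cutoff0 ?Iso0//; lra.
by rewrite bump1// Iso_le1.
Qed.

Definition smooth_unit d (F : 'rV[R]_d -> R) (g : 'rV[R]_d -> 'I_d -> R)
    (C t0 : R) :=
  [/\ 0 <= C, 0 < t0,
      forall x i t, `|F (x + t *: e_ i) - F x| <= `|t|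
    & forall x, \sum_i g x i ^+ 2 <= 1 /\
        forall i t, `|t| <= t0 ->
          `|F (x + t *: e_ i) - F x - t * g x i| <= C * t ^+ 2].

(** Since [n.+1 * t ^+ 2 = 1], the squares summed over all steps give the squared Euclidean norm of
    the gradient, up to a term of order [t]. *)
Lemma bobkov_discrete d F g C t0 rho eps k n : @smooth_unit d F g C t0 ->
  0 < eps -> 0 < k -> let t := (Num.sqrt n.+1%:R)^-1 in
  2 * t <= t0 -> 2 * t <= k ->
  Iso (walk (axes n.+1 t d) (fun x => cutoff rho eps (F x)) 0) <=
  (1 + eps^-1 * (1 + t * (d%:R * (4 * C + 4 * C ^+ 2)))) *
    walk (axes n.+1 t d) (fun x => bump rho eps k (F x)) 0.
Proof.
move=> [C0 t00 lipF grad] e0 k0 t tt0 tk.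
have N0 : 0 < n.+1%:R :> R by rewrite ltr0n.
have t_gt0 : 0 < t by rewrite invr_gt0 sqrtr_gt0.
have Nt : n.+1%:R * t ^+ 2 = 1.
  by rewrite exprVn sqr_sqrtr ?ltW// divff// gt_eqF.
have t1 : t <= 1.
  rewrite -[leRHS]invr1 lef_pV2 ?posrE ?sqrtr_gt0//.
  by rewrite -[leLHS]sqrtr1 ler_wsqrtr// ler1n.
pose chi y := bump rho eps k (F y).
have chi0 y : 0 <= chi y by have /andP[] := bump_itv rho eps k (F y).
(* At [h = t *: e_i] the sum is [t * g y i], and [D] is half the bound
   [2 * t * |g y i| + C * (2 * t) ^+ 2] on the increment of [F], scaled by the slope [eps^-1] and
   localised by [chi]. *)
pose D (h y : 'rV[R]_d) :=
  eps^-1 * (`|\sum_j g y j * h ord0 j| + 2 * C * t ^+ 2) * chi y.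
have DE i y : D (t *: e_ i) y = eps^-1 * (t * `|g y i| + 2 * C * t ^+ 2) * chi y.
  rewrite /D (bigD1 i)//= big1 ?addr0; last first.
    by move=> j /negbTE ji; rewrite !mxE ji andbF !mulr0.
  by rewrite !mxE !eqxx mulr1 normrM (gtr0_norm t_gt0) [t * _]mulrC.
have step i y u : `|u| = 2 * t ->
    `|cutoff rho eps (F y) - cutoff rho eps (F (y + u *: e_ i))|
      <= 2 * D (t *: e_ i) y.
  move=> u2; have [_ gy] := grad y.
  have -> : 2 * D (t *: e_ i) y =
    eps^-1 * (2 * t * `|g y i| + C * u ^+ 2) * chi y.
    by rewrite DE -(real_normK (num_real u)) u2; ring.
  apply: cutoff_bump => //; first by apply: le_trans (lipF _ _ _) _; rewrite u2.
  have := gy i u; rewrite u2 => /(_ tt0) h.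
  rewrite -[X in `|X|](subrK (u * g y i)) [X in _ <= X]addrC -u2 -normrM.
  by apply: le_trans (ler_normD _ _) _; rewrite lerD2r.
have := @bobkov_walk R _ (axes n.+1 t d) (fun x => cutoff rho eps (F x)) D 0
  (fun y => clamp01_itv _).
have ehh i : t *: e_ i + t *: e_ i = (2 * t) *: e_ i :> 'rV[R]_d.
  by rewrite -scalerDl mulr_natl mulr2n.
move=> H; apply: le_trans (H _ _) _ => {H}.
- by move=> h y /axesP[i ->]; rewrite ehh; apply: step; rewrite gtr0_norm ?mulr_gt0.
- move=> h y /axesP[i ->]; rewrite ehh -scaleNr.
  by apply: step; rewrite normrN gtr0_norm ?mulr_gt0.
rewrite -walkZ; apply: le_walk => y; rewrite axes_sum -/(chi y).
have [g1 _] := grad y.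
pose C' := d%:R * (4 * C + 4 * C ^+ 2).
have C'0 : 0 <= C'.
  by rewrite mulr_ge0// addr_ge0// mulr_ge0// sqr_ge0.
(* From [|g y i| <= 1] and [t <= 1], the terms [4 * C * t * |g y i|] and [4 * C ^+ 2 * t ^+ 2] are
   at most [t * (4 * C + 4 * C ^+ 2)] together. *)
have S1 : \sum_i (`|g y i| + 2 * C * t) ^+ 2 <= 1 + t * C'.
  apply: (le_trans (_ : _ <= \sum_i (g y i ^+ 2 + t * (4 * C + 4 * C ^+ 2)))).
    apply: ler_sum => i _; have gi : `|g y i| <= 1.
      rewrite -ler_sqr ?nnegrE// expr1n real_normK ?num_real//.
      apply: le_trans g1; rewrite (bigD1 i)//= lerDl.
      by apply: sumr_ge0 => j _; exact: sqr_ge0.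
    rewrite -[g y i ^+ 2](real_normK (num_real _)).
    have := ler_wpM2l C0 (ler_wpM2l (ltW t_gt0) gi).
    have := ler_wpM2l (sqr_ge0 C) (ler_wpM2l (ltW t_gt0) t1).
    by move: (`|g y i|) => G h1 h2; nra.
  rewrite big_split/= sumr_const card_ord -[X in _ + X <= _]mulr_natl.
  have -> : d%:R * (t * (4 * C + 4 * C ^+ 2)) = t * C' by rewrite /C'; ring.
  by rewrite lerD2r.
have -> : n.+1%:R * \sum_i D (t *: e_ i) y ^+ 2 =
    (eps^-1 * chi y) ^+ 2 * \sum_i (`|g y i| + 2 * C * t) ^+ 2.
  rewrite !mulr_sumr; apply: eq_bigr => i _; rewrite DE.
  have -> : eps^-1 * (t * `|g y i| + 2 * C * t ^+ 2) * chi y =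
    t * (eps^-1 * chi y * (`|g y i| + 2 * C * t)) by ring.
  by rewrite exprMn mulrA Nt mul1r exprMn.
have z0 : 0 <= t * C' by rewrite mulr_ge0// ltW.
have i0 : 0 <= eps^-1 by rewrite invr_ge0 ltW.
apply: sqrt_le; first by rewrite mulr_ge0// addr_ge0// mulr_ge0// addr_ge0.
rewrite -/C'; have Ib := Iso_cutoff_bump rho (F y) e0 k0.
have IB2 : Iso (cutoff rho eps (F y)) ^+ 2 <= chi y ^+ 2.
  by rewrite ler_sqr ?nnegrE ?Iso_ge0.
have B : (eps^-1 * chi y) ^+ 2 * \sum_i (`|g y i| + 2 * C * t) ^+ 2 <=
   (eps^-1 * chi y) ^+ 2 * (1 + t * C') ^+ 2.
  apply: ler_wpM2l; first exact: sqr_ge0.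
  by apply: le_trans S1 _; move: z0; set z := t * C' => z0; nra.
apply: le_trans (lerD IB2 B) _.
have c0 := chi0 y; move: z0 i0 c0; set z := t * C'; set a := eps^-1; set c := chi y.
move=> z0 i0 c0; have : 0 <= c * (a * c * (1 + z)).
  by rewrite !mulr_ge0// addr_ge0.
have -> : ((1 + a * (1 + z)) * c) ^+ 2 = c ^+ 2 + (a * c) ^+ 2 * (1 + z) ^+ 2
  + 2 * (c * (a * c * (1 + z))) by ring.
lra.
Qed.

Lemma gaussian_bobkov d F g C t0 rho eps k : @smooth_unit d F g C t0 ->
  0 < eps -> 0 < k ->
  Iso (gauss_mean (fun x => cutoff rho eps (F x))) <=
  (1 + eps^-1) * gauss_mean (fun x => bump rho eps k (F x)).
Proof.
move=> SU e0 k0; have [C0 t00 lipF _] := SU.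
set m := gauss_mean _; set X := gauss_mean _.
have lipf : coord_lip eps^-1 (fun x => cutoff rho eps (F x)).
  move=> x i t; apply: le_trans (cutoff_lip _ _ _ e0) _.
  by rewrite ler_wpM2l// invr_ge0 ltW.
have lipb : coord_lip k^-1 (fun x => bump rho eps k (F x)).
  move=> x i t; apply: le_trans (bump_lip _ _ _ _ k0) _.
  by rewrite ler_wpM2l// invr_ge0 ltW.
have i0 : 0 < eps^-1 by rewrite invr_gt0.
have X01 : 0 <= X <= 1.
  have k1 : 0 <= k^-1 by rewrite invr_ge0 ltW.
  by have [] := prob_integral01 (gaussian d) (continuous_measurable_rV
    (coord_lip_continuous k1 lipb)) (fun x => clamp01_itv _).
apply/ler_addgt0Pr => c c0.
(* With [a = eps^-1], [e <= 1] and [X <= 1], [(1 + a * (1 + e)) * (X + e)] exceeds [(1 + a) * X] by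
   at most [e * (1 + 3 * a)]. *)
pose e := Num.min 1 (c / 2 / (1 + 3 * eps^-1)).
have p3 : 0 < 1 + 3 * eps^-1 by lra.
have ee : 0 < e by rewrite lt_min ltr01 !divr_gt0.
have [ee1 ee2] : e <= 1 /\ e <= c / 2 / (1 + 3 * eps^-1).
  by rewrite /e !ge_min !lexx orbT.
have /cvgrPdist_lt/(_ (c / 2))Ic := @continuous_Iso R m.
have c2 : 0 < c / 2 by rewrite divr_gt0.
have {Ic} /nbhs_ballP[r /= r0 Ir] := Ic c2.
have r2 : 0 < r / 2 by rewrite divr_gt0.
have [n1 H1] := clt_rV d (ltW i0) r2.
have k10 : 0 <= k^-1 by rewrite invr_ge0 ltW.
have [n2 H2] := clt_rV d k10 ee.
pose C' := d%:R * (4 * C + 4 * C ^+ 2).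
have C'0 : 0 <= C' by rewrite mulr_ge0// addr_ge0// mulr_ge0// sqr_ge0.
(* A step [t <= q] meets both size conditions of [bobkov_discrete] and makes its error [t * C'] at
   most [e]. *)
pose q := Num.min (t0 / 2) (Num.min (k / 2) (e / (C' + 1))).
have C1 : 0 < C' + 1 by rewrite ltr_wpDl.
have q0 : 0 < q by rewrite !lt_min !divr_gt0.
pose n3 := Num.truncn (q^-1 ^+ 2).
pose n := maxn (maxn n1 n2) n3.
have n1n : (n1 <= n)%N by rewrite /n -maxnA leq_maxl.
have n2n : (n2 <= n)%N by rewrite /n (maxnC n1) -maxnA leq_maxl.
have n3n : (n3 <= n)%N by rewrite leq_maxr.
pose t : R := (Num.sqrt n.+1%:R)^-1.
have tq : t <= q.
  rewrite -[leRHS]invrK lef_pV2 ?posrE ?invr_gt0 ?sqrtr_gt0//.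
  rewrite -[leLHS]gtr0_norm ?invr_gt0// -sqrtr_sqr ler_wsqrtr//.
  by apply: le_trans (ltW (truncnS_gt _)) _; rewrite ler_nat ltnS.
have [qt qk qe] : [/\ q <= t0 / 2, q <= k / 2 & q <= e / (C' + 1)].
  by rewrite /q !ge_min !lexx !orbT.
have tt0 : 2 * t <= t0 by lra.
have tk : 2 * t <= k by lra.
have tC : t * C' <= e.
  apply: (le_trans (_ : _ <= q * (C' + 1))).
    have t0' : 0 <= t by rewrite invr_ge0.
    by apply: ler_pM => //; lra.
  by rewrite -ler_pdivlMr.
have := bobkov_discrete rho SU e0 k0 tt0 tk; rewrite -/C' -/t.
have := H1 n n1n _ lipf (fun x => clamp01_itv _).
have := H2 n n2n _ lipb (fun x => clamp01_itv _).
rewrite -/t -/m -/X; set W := walk _ _ _; set Wb := walk _ _ _ => wX wm bob.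
have : `|Iso m - Iso Wb| < c / 2.
  by apply: Ir; rewrite /ball/= distrC (le_lt_trans wm)// ltr_pdivrMr//; lra.
have {wX} WX : W <= X + e by move: wX; rewrite ler_norml; lra.
have fin : (1 + eps^-1 * (1 + t * C')) * W <= (1 + eps^-1) * X + c / 2.
  have W01 : 0 <= W <= 1 by apply: walk_itv => y; exact: clamp01_itv.
  apply: (le_trans (_ : _ <= (1 + eps^-1 * (1 + e)) * (X + e))).
    have t0' : 0 <= t * C' by rewrite mulr_ge0// invr_ge0.
    have p1 : 0 <= eps^-1 * (1 + t * C') by rewrite (mulr_ge0 (ltW i0))// addr_ge0.
    have p2 : eps^-1 * (1 + t * C') <= eps^-1 * (1 + e) by rewrite ler_pM2l// lerD2l.
    by apply: ler_pM => //; lra.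
  have : e * (1 + 3 * eps^-1) <= c / 2 by rewrite -ler_pdivlMr.
  move: i0 ee ee1 X01; set a := eps^-1 => i0 ee ee1 X01 h.
  have ae : 0 <= a * e by rewrite mulr_ge0// ltW.
  have h1 : a * e * X <= a * e * 1 by apply: ler_wpM2l => //; lra.
  have h2 : a * e * e <= a * e * 1 by exact: ler_wpM2l.
  lra.
by rewrite ltr_norml => /andP[_]; lra.
Qed.

End gaussian_bobkov.

(** * The Gaussian isoperimetric inequality *)

Section isoperimetry.
Context {R : realType}.

Definition enlarge d (A : set 'rV[R]_d) (r : R) : set 'rV[R]_d :=
  [set x | exists2 y, A y & enorm (x - y) < r].

Lemma continuous_subr (V : normedModType R) (y : V) : continuous (fun x => x - y).
Proof. by move=> z; apply: cvgB; [exact: cvg_id|exact: cvg_cst]. Qed.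

Lemma open_enlarge d (A : set 'rV[R]_d) r : open (enlarge A r).
Proof.
rewrite [X in open X](_ : _ = \bigcup_(y in A) [set x | enorm (x - y) < r]);
  last first.
  by apply/seteqP; split => x [y Ay xy]; exists y.
apply: bigcup_open => y _.
rewrite [X in open X](_ : _ = (fun x => enorm (x - y)) @^-1` [set u | u < r])//.
apply: open_comp; last exact: open_lt.
move=> x _.
exact: (continuous_comp (@continuous_subr 'rV[R]_d y x) (@enorm_continuous R d _)).
Qed.

Lemma measurable_enlarge d (A : set 'rV[R]_d) r : measurable (enlarge A r).
Proof. by apply: open_measurable_rV; exact: open_enlarge. Qed.

Lemma le_enlarge d (A : set 'rV[R]_d) r s : r <= s -> enlarge A r `<=` enlarge A s.
Proof. by move=> rs x [y Ay xy]; exists y => //; exact: lt_le_trans rs. Qed.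

Section prob.
Context d' (T : measurableType d') (P : probability T R).
Implicit Types (G : T -> R) (A B : set T).

Lemma prob_fine A : measurable A -> P A = (fine (P A))%:E.
Proof. by move=> mA; rewrite fineK// fin_num_measure. Qed.

Lemma prob_le_mean G A : measurable_fun setT G -> (forall x, 0 <= G x <= 1) ->
  measurable A -> (forall x, A x -> G x = 1) -> fine (P A) <= \int[P]_x G x.
Proof.
move=> mG G01 mA AG.
have [E _] := prob_integral01 P mG G01; rewrite -lee_fin -E -prob_fine//.
rewrite -(setIT A) -integral_indic//; apply: ge0_le_integral => //.
- exact/measurable_EFinP/measurable_indic.
- exact/measurable_EFinP.
- move=> x _; rewrite lee_fin indicE; have /andP[? ?] := G01 x.
  by have [/[!inE] Ax|_] := boolP (x \in A); rewrite ?(AG _ Ax).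
Qed.

Lemma mean_le_prob G A : measurable_fun setT G -> (forall x, 0 <= G x <= 1) ->
  measurable A -> (forall x, ~ A x -> G x = 0) -> \int[P]_x G x <= fine (P A).
Proof.
move=> mG G01 mA AG.
have [E _] := prob_integral01 P mG G01; rewrite -lee_fin -E -prob_fine//.
rewrite -(setIT A) -integral_indic//; apply: ge0_le_integral => //.
- by move=> x _; rewrite lee_fin; case/andP: (G01 x).
- exact/measurable_EFinP.
- exact/measurable_EFinP/measurable_indic.
- move=> x _; rewrite lee_fin indicE; have /andP[? ?] := G01 x.
  by have [_|/negP] := boolP (x \in A); rewrite // inE => Ax; rewrite AG.
Qed.

Lemma le_prob_fine A B : measurable A -> measurable B -> A `<=` B ->
  fine (P A) <= fine (P B).
Proof. by move=> mA mB AB; rewrite -lee_fin -!prob_fine// le_measure ?inE. Qed.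

Lemma prob_fine_setD A B : measurable A -> measurable B -> A `<=` B ->
  fine (P (B `\` A)) = fine (P B) - fine (P A).
Proof.
move=> mA mB AB; rewrite measureD//; last by rewrite -ge0_fin_numE ?fin_num_measure.
have -> : B `&` A = A by rewrite setIC; apply/setIidPl.
by rewrite fineB// fin_num_measure.
Qed.

Lemma prob_fine_itv A : measurable A -> 0 <= fine (P A) <= 1.
Proof. by move=> mA; rewrite -!lee_fin -prob_fine// measure_ge0 probability_le1. Qed.

End prob.

Lemma enlarge_step d n (a : 'I_n.+1 -> 'rV[R]_d) (r1 r2 eps : R) :
  let v r := fine (gaussian d (enlarge (range a) r)) in
  0 < eps -> eps < r2 - r1 ->
  exists2 m, v r1 <= m <= v r2 & Iso m <= (1 + eps^-1) * (v r2 - v r1).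
Proof.
(* The spare width [6 * k] gives each side [k] for the error of [F] and [2 * k] for the flank of
   [bump]: with [rho = r1 + 3 * k], the bump vanishes on the [r1]-neighbourhood and off the
   [r2]-neighbourhood. *)
move=> v e0 er; pose k := (r2 - r1 - eps) / 6.
have k0 : 0 < k by rewrite divr_gt0//; lra.
have ek : r2 = r1 + eps + 6 * k by rewrite /k; field.
have [F [g [C [t0 [[C0 t00] lipF grad near1 near2]]]]] := smooth_distance a k0.
have SU : smooth_unit F g C t0 by split.
pose rho := r1 + 3 * k.
have in1 x : enlarge (range a) r1 x -> F x < r1 + k.
  by move=> [_ [j _ <-]]; exact: near1.
have out2 x : ~ enlarge (range a) r2 x -> r2 - k <= F x.
  move=> h; rewrite leNgt; apply/negP => /near2[j]; rewrite subrK => xj.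
  by apply: h; exists (a j) => //; exists j.
have lipf : coord_lip eps^-1 (fun x => cutoff rho eps (F x)).
  move=> x i t; apply: le_trans (cutoff_lip _ _ _ e0) _.
  by rewrite ler_wpM2l// invr_ge0 ltW.
have lipb : coord_lip k^-1 (fun x => bump rho eps k (F x)).
  move=> x i t; apply: le_trans (bump_lip _ _ _ _ k0) _.
  by rewrite ler_wpM2l// invr_ge0 ltW.
have i0 : 0 <= eps^-1 by rewrite invr_ge0 ltW.
have k1 : 0 <= k^-1 by rewrite invr_ge0 ltW.
have mc := continuous_measurable_rV (coord_lip_continuous i0 lipf).
have mb := continuous_measurable_rV (coord_lip_continuous k1 lipb).
have c01 x : 0 <= cutoff rho eps (F x) <= 1 by exact: clamp01_itv.
have b01 x : 0 <= bump rho eps k (F x) <= 1 by exact: clamp01_itv.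
exists (gauss_mean (fun x => cutoff rho eps (F x))).
  apply/andP; split.
    apply: prob_le_mean => //; first exact: measurable_enlarge.
    by move=> x /in1 h; apply: cutoff1 => //; rewrite /rho; lra.
  apply: mean_le_prob => //; first exact: measurable_enlarge.
  by move=> x /out2 h; apply: cutoff0 => //; rewrite /rho; lra.
apply: le_trans (gaussian_bobkov rho SU e0 k0) _.
apply: ler_wpM2l; first by rewrite addr_ge0.
rewrite -prob_fine_setD; [|exact: measurable_enlarge..|]; last first.
  by apply: le_enlarge; lra.
apply: mean_le_prob => //; first by apply: measurableD; exact: measurable_enlarge.
move=> x /not_andP[/out2 h|/contrapT/in1 h].
  by apply: bump0r => //; rewrite /rho; lra.
by apply: bump0l => //; rewrite /rho; lra.
Qed.

(** By the mean value theorem [q - p = phi c * (qn q - qn p)], and [Iso m = phi z] with [c] and [z]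
    both between [qn p] and [qn q]. Unless the increment already exceeds [de],
    [phi z >= phi c * (1 - M * de)], and dividing by [phi c] turns the hypothesis into a lower bound
    on the increment. *)
Lemma qn_step (p q M de m : R) : 0 < p -> q < 1 -> p <= q ->
  0 < de -> de <= 1 / 2 -> 0 <= M -> M * de <= 1 ->
  `|qn p| <= M -> `|qn q| <= M ->
  p <= m <= q -> Iso m <= (1 + (de * (1 - de))^-1) * (q - p) ->
  de - (M + 2) * de ^+ 2 <= qn q - qn p.
Proof.
move=> p0 q1 pq d0 d2 M0 Md pM qM mpq im.
have [p01 q01 m01] : [/\ 0 < p < 1, 0 < q < 1 & 0 < m < 1] by split; lra.
set y1 := qn p in pM *; set y2 := qn q in qM *.
have y12 : y1 <= y2 by rewrite qn_le.
have Mde : 0 <= (M + 2) * de ^+ 2 by rewrite mulr_ge0 ?sqr_ge0//; lra.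
have [big|small] := ltP de (y2 - y1); first lra.
set z := qn m; have [z1 z2] : y1 <= z /\ z <= y2 by rewrite !qn_le//; lra.
have [|c cy e] := @MVT_segment _ Ph phi y1 y2 y12 (fun x _ => is_derive_Ph x).
  by apply: continuous_subspaceT; exact: continuous_Ph.
move: e; rewrite /y1 /y2 !Ph_qn// -/y1 -/y2 => e.
move: cy; rewrite in_itv/= => /andP[c1 c2].
have IsoE : Iso m = phi z by rewrite /Iso m01.
have ratio : phi c * (1 - M * de) <= phi z.
  have hz : (z ^+ 2 - c ^+ 2) / 2 <= M * de.
    move: pM qM; rewrite !ler_norml => /andP[p1 p2] /andP[q2 q3].
    have zc : `|z - c| <= de by rewrite ler_norml; lra.
    have zpc : `|z + c| <= 2 * M by rewrite ler_norml; lra.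
    have := ler_pM (normr_ge0 _) (normr_ge0 _) zpc zc.
    rewrite -normrM; have := ler_norm ((z + c) * (z - c)).
    have -> : (z + c) * (z - c) = z ^+ 2 - c ^+ 2 by ring.
    by lra.
  have -> : phi z = phi c * expR (- ((z ^+ 2 - c ^+ 2) / 2)).
    by rewrite !phiE -[RHS]mulrA -expRD; congr (_ * expR _); field.
  rewrite ler_pM2l ?phi_gt0//.
  by have := expR_ge1Dx (- ((z ^+ 2 - c ^+ 2) / 2)); lra.
have Y0 : 0 <= y2 - y1 by lra.
have pc := phi_gt0 c.
set Y := y2 - y1 in e small Y0 *.
have main : 1 - M * de <= (1 + (de * (1 - de))^-1) * Y.
  rewrite -(ler_pM2l pc); apply: (le_trans ratio); rewrite -IsoE.
  by apply: le_trans im _; rewrite e; lra.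
have ep : 0 < de * (1 - de) by rewrite mulr_gt0//; lra.
have : de * (1 - de) * (1 - M * de) <= (1 + de) * Y.
  have := ler_wpM2l (ltW ep) main.
  have -> : de * (1 - de) * ((1 + (de * (1 - de))^-1) * Y) = (de * (1 - de) + 1) * Y.
    by field; apply/andP; split; rewrite gt_eqF//; lra.
  move=> h; apply: le_trans h _; apply: ler_wpM2r => //.
  by have := sqr_ge0 de; lra.
move=> h.
have h1 : (1 - de) * ((1 + de) * Y) <= Y.
  have -> : (1 - de) * ((1 + de) * Y) = Y - de ^+ 2 * Y by ring.
  by rewrite gerBl mulr_ge0// sqr_ge0.
apply: le_trans h1; apply: le_trans (ler_wpM2l _ h); last by lra.
have d3 : 0 <= de ^+ 3 by rewrite exprn_ge0// ltW.
have Md0 : 0 <= 1 - M * de by lra.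
have := mulr_ge0 Md0 d3; have := mulr_ge0 M0 d3.
have -> : (1 - de) * (de * (1 - de) * (1 - M * de)) =
  de - (M + 2) * de ^+ 2 + (1 - M * de) * de ^+ 3 + 2 * (M * de ^+ 3) by ring.
lra.
Qed.

(* The difference inequality is summed over a fine subdivision of [[a, b]]. *)
Lemma qn_growth (v : R -> R) (a b : R) : a < b -> 0 < v a -> v b < 1 ->
  {homo v : r s / r <= s} ->
  (forall r1 r2 eps, 0 < eps -> eps < r2 - r1 ->
    exists2 m, v r1 <= m <= v r2 & Iso m <= (1 + eps^-1) * (v r2 - v r1)) ->
  b - a <= qn (v b) - qn (v a).
Proof.
move=> ab va vb vmono step; set L := b - a; have L0 : 0 < L by rewrite subr_gt0.
pose M := Num.max `|qn (v a)| `|qn (v b)|.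
have M0 : 0 <= M by rewrite le_max normr_ge0.
have itv r : a <= r -> r <= b -> 0 < v r < 1.
  move=> ar rb; have := vmono _ _ ar; have := vmono _ _ rb; lra.
have bound r : a <= r -> r <= b -> `|qn (v r)| <= M.
  move=> ar rb; have h1 : qn (v a) <= qn (v r).
    by rewrite qn_le ?vmono// itv//; lra.
  have h2 : qn (v r) <= qn (v b) by rewrite qn_le ?vmono// itv//; lra.
  have [m1 m2] : `|qn (v a)| <= M /\ `|qn (v b)| <= M.
    by rewrite /M !le_max !lexx orbT.
  by move: m1 m2; rewrite !ler_norml; lra.
apply/ler_addgt0Pr => c c0.
(* The three bounds give, in order, [de <= 1 / 2], [M * de <= 1], and a total loss
   [k%:R * (M + 2) * de ^+ 2] of at most [c]. *)
pose X := Num.max (2 * L) (Num.max (M * L) ((M + 2) * L ^+ 2 / c)).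
pose k := (Num.truncn X).+1; have kX : X <= k%:R by apply: ltW; exact: truncnS_gt.
have k0 : 0 < k%:R :> R by rewrite ltr0n.
have [k1 k2 k3] : [/\ 2 * L <= k%:R, M * L <= k%:R & (M + 2) * L ^+ 2 / c <= k%:R].
  by move: kX; rewrite /X !ge_max => /and3P[].
pose de := L / k%:R; have d0 : 0 < de by rewrite divr_gt0.
have dk : k%:R * de = L by rewrite /de mulrC divfK// gt_eqF.
have d2 : de <= 1 / 2 by rewrite /de ler_pdivrMr//; lra.
have Md : M * de <= 1 by rewrite /de mulrA ler_pdivrMr// mul1r.
have iter (i : nat) : (i <= k)%N ->
    i%:R * (de - (M + 2) * de ^+ 2) <= qn (v (a + i%:R * de)) - qn (v a).
  elim: i => [_|i IH ik]; first by rewrite !mul0r addr0 subrr.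
  have ib : (i.+1)%:R * de <= L by rewrite -dk ler_pM2r// ler_nat.
  have ei : i.+1%:R * de = i%:R * de + de by rewrite -(natr1 i); ring.
  have i0 : 0 <= i%:R * de by rewrite mulr_ge0// ltW.
  set r1 := a + i%:R * de; have -> : a + i.+1%:R * de = r1 + de by rewrite ei addrA.
  have [ar1 r1b r2b] : [/\ a <= r1, r1 <= b & r1 + de <= b].
    by rewrite /r1; move: ib; rewrite ei /L; split; lra.
  (* The step inequality needs a width strictly below the mesh; [de * (1 - de)] costs only a
     second-order term. *)
  have ep : 0 < de * (1 - de) by rewrite mulr_gt0//; lra.
  have ed : de * (1 - de) < r1 + de - r1.
    have -> : r1 + de - r1 = de by ring.
    by rewrite gtr_pMr// gtrBl.
  have [m mm Im] := step _ _ _ ep ed.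
  have := IH (ltnW ik); rewrite -/r1.
  have := @qn_step (v r1) (v (r1 + de)) M de m _ _ _ d0 d2 M0 Md
     (bound _ ar1 r1b) (bound _ _ r2b) mm Im.
  have /andP[w1 _] := itv _ ar1 r1b.
  have ar2 : a <= r1 + de by lra.
  have /andP[_ w2] := itv _ ar2 r2b.
  have w3 : v r1 <= v (r1 + de) by apply: vmono; lra.
  move=> /(_ w1 w2 w3 ar2).
  rewrite -(natr1 i) [(_ + 1) * _]mulrDl mul1r; lra.
have := iter k (leqnn k); rewrite dk.
have -> : a + L = b by rewrite /L; ring.
rewrite mulrBr dk => h.
have : k%:R * ((M + 2) * de ^+ 2) <= c.
  have -> : k%:R * ((M + 2) * de ^+ 2) = (M + 2) * L ^+ 2 / k%:R.
    by rewrite /de; field; rewrite gt_eqF.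
  by move: k3; rewrite !ler_pdivrMr// [c * _]mulrC.
lra.
Qed.

Lemma isoperimetry_finite d n (a : 'I_n.+1 -> 'rV[R]_d) (x r s : R) : r < s ->
  ((Ph x)%:E <= gaussian d (enlarge (range a) r))%E ->
  ((Ph (x + (s - r)))%:E <= gaussian d (enlarge (range a) s))%E.
Proof.
move=> rs.
rewrite (prob_fine (gaussian d) (measurable_enlarge (range a) r)).
rewrite (prob_fine (gaussian d) (measurable_enlarge (range a) s)) !lee_fin.
pose v u := fine (gaussian d (enlarge (range a) u)); rewrite -/(v r) -/(v s) => xr.
have v01 u : 0 <= v u <= 1 by apply: prob_fine_itv; exact: measurable_enlarge.
have [|v1] := leP 1 (v s); first by apply: le_trans; exact: Ph_le1.
have vr : 0 < v r by apply: lt_le_trans xr; exact: Ph_gt0.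
have vmono : {homo v : u w / u <= w}.
  by move=> u w uw; apply: le_prob_fine; [exact: measurable_enlarge..|exact: le_enlarge].
have vrs := vmono _ _ (ltW rs).
have r01 : 0 < v r < 1 by lra.
have s01 : 0 < v s < 1 by lra.
have gr := qn_growth rs vr v1 vmono (@enlarge_step d n a).
have xq : x <= qn (v r) by rewrite -Ph_leE Ph_qn.
have : x + (s - r) <= qn (v s) by lra.
by rewrite -Ph_leE Ph_qn.
Qed.

End isoperimetry.

(** * From finite sets to Borel sets *)

Section isoperimetry_borel.
Context {R : realType}.

Lemma enorm_le_sup d (v : 'rV[R]_d) (c : R) : 0 <= c -> (forall i, `|v ord0 i| <= c) ->
  enorm v <= (d%:R + 1) * c.
Proof.
move=> c0 vc; have d0 : 0 <= d%:R :> R by [].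
apply: sqrt_le; first by rewrite mulr_ge0// addr_ge0.
apply: (le_trans (_ : _ <= \sum_(i < d) c ^+ 2)).
  apply: ler_sum => i _; rewrite -(real_normK (num_real _)) ler_sqr ?nnegrE//.
have -> : \sum_(i < d) c ^+ 2 = d%:R * c ^+ 2 by rewrite sumr_const card_ord mulr_natl.
by rewrite exprMn; apply: ler_wpM2r; [exact: sqr_ge0|nra].
Qed.

(* One point of [A] in each rational box meeting [A]. *)
Lemma dense_sequence d (A : set 'rV[R]_d) (r : R) : A !=set0 -> 0 < r ->
  exists2 a : nat -> 'rV[R]_d, (forall n, A (a n)) &
    forall y, A y -> exists n, enorm (y - a n) < r.
Proof.
move=> [y0 Ay0] r0; have d1 : 0 < d%:R + 1 :> R by rewrite ltr_wpDl.
pose c := r / (d%:R + 1) / 4; have c0 : 0 < c by rewrite !divr_gt0.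
pose box (q : 'rV[rat]_d) : set 'rV[R]_d :=
  [set v | forall i, `|v ord0 i - ratr (q ord0 i)| < c].
pose pt (q : 'rV[rat]_d) := xget y0 (A `&` box q).
have Apt q : A (pt q) by rewrite /pt; case: xgetP => [x _ []|].
pose a n := if unpickle n is Some q then pt q else y0.
exists a => [n|y Ay]; first by rewrite /a; case: unpickle.
have /choice[q qP] (i : 'I_d) : exists q : rat, `|y ord0 i - ratr q| < c.
  have /rat_in_itvoo[q] : y ord0 i - c < y ord0 i + c.
    by rewrite ltrBlDr -addrA ltrDl addr_gt0.
  by rewrite in_itv/= => qi; exists q; rewrite distrC ltr_distl.
pose Q := \row_i q i; exists (pickle Q); rewrite /a pickleK.
have boxy : (A `&` box Q) y by split => // i; rewrite mxE.
have boxpt : box Q (pt Q) by rewrite /pt; case: xgetP => [x _ []|/(_ y)].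
apply: (@le_lt_trans _ _ ((d%:R + 1) * (2 * c))).
  apply: enorm_le_sup; first by rewrite mulr_ge0// ltW.
  move=> i; rewrite !mxE; have := boxpt i; have := qP i; rewrite mxE.
  by rewrite ler_norml !ltr_norml; lra.
have -> : (d%:R + 1) * (2 * c) = r / 2 by rewrite /c; field; rewrite gt_eqF.
lra.
Qed.

Lemma isoperimetry d (A : set 'rV[R]_d) (x r : R) : measurable A -> 0 < r ->
  ((Ph x)%:E <= gaussian d A)%E -> ((Ph (x + r))%:E <= gaussian d (enlarge A r))%E.
Proof.
move=> mA r0 xA.
have A0 : A !=set0.
  apply/set0P; apply/eqP => A0; move: xA; rewrite A0 measure0 lee_fin.
  by rewrite leNgt Ph_gt0.
(* One [t] is lost in passing to [Ph (x - t)], a strict inequality that survives at a finite stage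
   of the covering, and another because the balls of the covering use up radius [t]. *)
have main t : 0 < t -> t < r ->
    ((Ph (x + r - 2 * t))%:E <= gaussian d (enlarge A r))%E.
  move=> t0 tr; have [a Aa cover] := dense_sequence A0 t0.
  pose E n := enlarge (range (fun j : 'I_n.+1 => a j)) t.
  have [|i j ij y||n xE] := @probability_bigcup_gt _ _ _ (gaussian d) E (Ph (x - t))%:E.
  - by move=> n; exact: measurable_enlarge.
  - move=> [_ [k _ <-] yk]; exists (a k) => //.
    by exists (widen_ord (ij : i.+1 <= j.+1)%N k).
  - apply: lt_le_trans (_ : gaussian d A <= _)%E; last first.
      apply: le_measure; rewrite ?inE//.
        by apply: bigcup_measurable => k _; exact: measurable_enlarge.
      move=> y /cover[n yn]; exists n => //; exists (a n) => //.
      by exists ord_max.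
    by apply: lt_le_trans xA; rewrite lte_fin Ph_ltE; lra.
  have := isoperimetry_finite tr (ltW xE).
  have -> : x - t + (r - t) = x + r - 2 * t by ring.
  move=> h; apply: le_trans h _.
  apply: le_measure; rewrite ?inE; try exact: measurable_enlarge.
  by move=> y [_ [k _ <-] yk]; exists (a k).
rewrite (prob_fine (gaussian d) (measurable_enlarge _ _)) lee_fin.
set V := fine _; rewrite leNgt; apply/negP => lt.
have cP : {for (0 : R), continuous (fun t : R => Ph (x + r - 2 * t))}.
  apply: (@continuous_comp _ _ _ (fun t : R => x + r - 2 * t) Ph); last exact: continuous_Ph.
  by apply: cvgB; [exact: cvg_cst|apply: cvgMr; exact: cvg_id].
have lt0 : V < Ph (x + r - 2 * 0) by rewrite mulr0 subr0.
have : \forall t \near (0 : R)^'+, V < Ph (x + r - 2 * t).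
  by apply: cvg_within; exact: (cvgr_gt _ cP _ lt0).
move=> hn; near (0 : R)^'+ => t.
have t0 : 0 < t by near: t; exact: nbhs_right_gt.
have tr : t < r by near: t; exact: nbhs_right_lt.
have := main t t0 tr.
rewrite (prob_fine (gaussian d) (measurable_enlarge _ _)) lee_fin -/V.
rewrite leNgt => /negP; apply; near: t; exact: hn.
Unshelve. all: by end_near. Qed.

End isoperimetry_borel.

(** * The rearrangement inequality *)

Section half_line_rearrangement.
Context {R : realType}.

(** Applying the increasing [Ph] removes the quantile; the conventions at measure [0] and [1] agree
    with [0 <= Ph y < 1]. *)
Lemma set_starE d (A : set 'rV[R]_d) (y : R) : measurable A ->
  set_star A y <-> (Phi y < gaussian d A)%E.
Proof.
move=> mA; rewrite /set_star/= /Phi_inv Phi_fin (prob_fine (gaussian d) mA).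
set p := fine _; have p01 : 0 <= p <= 1 by exact: prob_fine_itv.
have -> : (p%:E == 0)%E = (p == 0) by exact: eqe.
have -> : (p%:E == 1)%E = (p == 1) by exact: eqe.
rewrite lte_fin.
case: eqP => [->|/eqP p0].
  by rewrite ltNge leNye/= ltNge Ph_ge0.
case: eqP => [->|/eqP p1]; first by rewrite ltry Ph_lt1.
have pi : 0 < p < 1 by lra.
have [x xp] := Ph_surj pi; rewrite lte_fin.
case: xgetP => [z _ /= zp|/(_ x)]; last by rewrite /= Phi_fin xp.
move: zp; rewrite Phi_fin => -[<-]; by rewrite Ph_ltE.
Qed.

Lemma measurable_superlevel d (f : 'rV[R]_d -> R) (r : R) :
  measurable_fun setT f -> measurable [set z | r < f z].
Proof.
move=> mf; rewrite -[X in measurable X]setTI.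
rewrite (_ : [set z | r < f z] = f @^-1` `]r, +oo[%classic); first exact: mf.
by apply/seteqP; split => z /=; rewrite in_itv/= andbT.
Qed.

(** The levels [r] whose half-line contains [y] form a down-set [S]; if none exceeded [T], the
    layer-cake integral over positive levels would be at most [T]. *)
Lemma fun_star_gt d (f : 'rV[R]_d -> R) (y T : R) : measurable_fun setT f ->
  0 <= T -> (T%:E < fun_star f y)%E ->
  exists2 r, T < r & (Phi y < gaussian d [set z | (r < f z)%R])%E.
Proof.
move=> mf T0 Tf; apply: contrapT => h.
have mA r := measurable_superlevel r mf.
pose S := [set r : R | (Phi y < gaussian d [set z | (r < f z)%R])%E].
have mS : measurable S.
  apply: is_interval_measurable => a b Sa Sb c /andP[ac cb].
  apply: lt_le_trans Sb _; apply: le_measure; rewrite ?inE// => z /=.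
  exact: le_lt_trans.
have ST r : S r -> r <= T by move=> Sr; rewrite leNgt; apply/negP => Tr; apply: h; exists r.
suff : (fun_star f y <= T%:E)%E by rewrite leNgt Tf.
have -> : fun_star f y = (\int[lebesgue_measure]_(r in `]0%R, +oo[) (\1_S r)%:E)%E.
  apply: eq_integral => r _; rewrite !indicE; congr ((nat_of_bool _)%:R%:E).
  apply/idP/idP; rewrite !inE => H.
    exact: (set_starE y (mA r)).1 H.
  exact: (set_starE y (mA r)).2 H.
rewrite integral_indic//.
apply: (@le_trans _ _ (lebesgue_measure `]0, T]%classic)).
  apply: le_measure; rewrite ?inE;
    [apply: measurableI => //; exact: measurable_itv|exact: measurable_itv|].
  by move=> r [/ST rT]; rewrite /= !in_itv/= andbT => ->.
by rewrite lebesgue_measure_itv/= lte_fin; case: ifPn => //; rewrite -EFinB subr0.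
Qed.

(** In the main case [U] lies in the half-line up to [qn m], of measure [m]. This lets the
    right-hand set of the theorem be treated point by point. *)
Lemma gamma_le_of_Ph (U : set R) (m : R) : measurable (U : set (measurableTypeR R)) ->
  0 <= m -> (forall x, U x -> Ph x <= m) -> (gamma U <= m%:E)%E.
Proof.
move=> mU m0 h; have [m1|m1] := leP 1 m.
  by apply: le_trans (probability_le1 _ mU) _; rewrite lee_fin.
have [m00|mn0] := eqVneq m 0.
  rewrite (_ : U = set0) ?measure0 ?lee_fin//.
  by apply/seteqP; split => // x /h; rewrite m00 leNgt Ph_gt0.
have m01 : 0 < m < 1 by lra.
apply: (@le_trans _ _ (gamma `]-oo, qn m]%classic)).
  apply: le_measure; rewrite ?inE//.
  by move=> x /h xm; rewrite /= in_itv/= -Ph_leE Ph_qn.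
rewrite (prob_fine gamma) ?lee_fin; last exact: measurable_itv.
by rewrite -[leRHS](Ph_qn m01) PhE.
Qed.

Lemma enorm_sqr d (v : 'rV[R]_d) : enorm v ^+ 2 = \sum_i v ord0 i ^+ 2.
Proof. by rewrite sqr_sqrtr// sumr_ge0// => i _; exact: sqr_ge0. Qed.

Lemma enlarge_sub_Q d (f : 'rV[R]_d -> R) (lambda s r rho : R) : 0 < lambda ->
  0 < rho -> s < r * expR (- (rho ^+ 2 / (2 * lambda))) -> 0 < s ->
  enlarge [set z | r < f z] rho `<=` [set z | (s%:E < Q_rV lambda (EFin \o f) z)%E].
Proof.
move=> l0 rho0 sr s0 z [a /= ra za].
apply: (@lt_le_trans _ _ (f a * expR (- (rho ^+ 2 / (2 * lambda))))%:E).
  by rewrite lte_fin; apply: lt_trans sr _; rewrite ltr_pM2r ?expR_gt0.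
apply: (@le_trans _ _ (f a * expR (- (lambda * enorm (lambda^-1 *: (a - z)) ^+ 2 / 2)))%:E).
  have f0 : 0 <= f a.
    have : 0 < r * expR (- (rho ^+ 2 / (2 * lambda))) by lra.
    by rewrite pmulr_lgt0 ?expR_gt0// => r0; lra.
  rewrite lee_fin ler_wpM2l// ler_expR lerN2.
  have -> : enorm (lambda^-1 *: (a - z)) ^+ 2 = lambda^-1 ^+ 2 * enorm (z - a) ^+ 2.
    by rewrite !enorm_sqr mulr_sumr; apply: eq_bigr => i _; rewrite !mxE; ring.
  have -> : lambda * (lambda^-1 ^+ 2 * enorm (z - a) ^+ 2) / 2 =
    enorm (z - a) ^+ 2 / (2 * lambda) by field; rewrite gt_eqF.
  rewrite ler_pM2r ?invr_gt0 ?mulr_gt0// ler_sqr ?nnegrE ?sqrtr_ge0 ?ltW//.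
apply: ereal_sup_ubound; exists (lambda^-1 *: (a - z)) => //.
by rewrite scalerA mulfV ?gt_eqF// scale1r addrC subrK.
Qed.

End half_line_rearrangement.

Theorem theorem6p5 (R : realType) (d : nat) (f : 'rV[R]_d -> R)
    (mf : measurable_fun [set: 'rV[R]_d] f) (f0 : forall x, 0 <= f x)
    (lambda s : R) (lambda0 : 0 < lambda) (s0 : 0 < s) :
  (gaussian d [set z : 'rV[R]_d | s%:E < Q_rV lambda (EFin \o f) z]
   >= gamma [set x : R | s%:E < Q_R lambda (fun_star f) x])%E.
Proof.
have mZ := @measurable_Q_rV_gt R d lambda s (EFin \o f) lambda0.
have mU := @measurable_Q_R_gt R lambda s (fun_star f) lambda0.
rewrite (prob_fine (gaussian d) mZ); apply: gamma_le_of_Ph => //.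
  by have /andP[] := prob_fine_itv (gaussian d) mZ.
(* The witness [w] yields a level [r] with [Phi y < gaussian d {f > r}]; then
   [x <= y + lambda * |w|], and isoperimetry from [y] with a radius [rho > lambda * |w|] bounds
   [Ph x]. *)
move=> x /= /ereal_sup_gt[_ [w _ <-]]; set y := x + lambda *: w.
set E := expR _ => sE; have E0 : 0 < E := expR_gt0 _.
have T0 : 0 <= s / E by rewrite divr_ge0// ltW.
have [|r Tr yr] := fun_star_gt mf T0 (y := y).
  by rewrite EFinM lte_pdivrMr.
have rE : s < r * E by rewrite -ltr_pdivrMr.
pose rho0 := lambda * `|w|.
have rho00 : 0 <= rho0 by rewrite mulr_ge0// ltW.
(* The radius must be positive, and [lambda * |w|] may be [0]; the strict inequality [rE] leaves
   room to enlarge it. *)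
have [rho rho1 rho2] : exists2 rho, rho0 < rho &
    s < r * expR (- (rho ^+ 2 / (2 * lambda))).
  pose g (u : R) := r * expR (- (u ^+ 2 / (2 * lambda))).
  have cg : continuous g.
    have ce : continuous (fun u : R => - (u ^+ 2 / (2 * lambda))).
      by move=> u; apply: cvgN; apply: cvgMl; exact: exprn_continuous.
    by move=> u; apply: cvgMr; exact: (continuous_comp (ce u) (@continuous_expR R _)).
  have g0 : s < g rho0.
    rewrite /g /rho0 (_ : _ ^+ 2 / _ = lambda * `|w| ^+ 2 / 2)//.
    by field; rewrite gt_eqF.
  have hn : \forall u \near rho0^'+, s < g u.
    by apply: cvg_within; exact: (cvgr_gt _ (cg rho0) _ g0).
  near rho0^'+ => rho; exists rho; near: rho; last exact: hn.
  exact: nbhs_right_gt.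
have rho_gt0 : 0 < rho by exact: le_lt_trans rho1.
have mA := measurable_superlevel r mf.
have yA : ((Ph y)%:E <= gaussian d [set z | (r < f z)%R])%E by rewrite -Phi_fin ltW.
rewrite -lee_fin -(prob_fine (gaussian d) mZ).
apply: (@le_trans _ _ (Ph (y + rho))%:E).
  rewrite lee_fin Ph_leE /y; have := ler_norm (- (lambda *: w)).
  rewrite normrN normrZ (gtr0_norm lambda0) -/rho0; lra.
apply: le_trans (isoperimetry mA rho_gt0 yA) _.
apply: le_measure; rewrite ?inE//; first exact: measurable_enlarge.
exact: enlarge_sub_Q.
Unshelve. all: by end_near. Qed.
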